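(* Neither 3SAT(Horn-backdoor) nor 3SAT(2CNF-backdoor) admits a polynomial kernel unless $\mathrm{NP} \subseteq \mathrm{coNP}/\mathrm{poly}$.
   Context: A 3CNF formula is a CNF formula each of whose clauses has at most 3 literals; a 2CNF formula has clauses of at most 2 literals; a Horn formula is a CNF formula each of whose clauses has at most one positive literal. For a CNF formula $F$ and a truth assignment $\tau$ to a set of variables, $F[\tau]$ is obtained by removing satisfied clauses and deleting false literals from the remaining clauses. For a class $\mathscr{C}\in\{\text{Horn},\text{2CNF}\}$, a $\mathscr{C}$-backdoor of $F$ is a set $B$ of variables such that $F[\tau]\in\mathscr{C}$ for every truth assignment $\tau$ to $B$. 3SAT($\mathscr{C}$-backdoor): given a 3CNF formula $F$ and a $\mathscr{C}$-backdoor $B$ of $F$ of size $k$, with parameter $k$, decide whether $F$ is satisfiable. A kernelization for a parameterized problem $P\subseteq\Sigma^*\times\mathbb{N}$ is a polynomial-time algorithm mapping $(x,k)$ to $(x',k')$ with $(x,k)\in P\iff(x',k')\in P$ and $|x'|+k'\le g(k)$ for a computable $g$; it is a polynomial kernel if $g$ is a polynomial. *)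

(* Defs.v *)
From mathcomp Require Import all_boot.
Set Implicit Arguments. Unset Strict Implicit. Unset Printing Implicit Defensive.

(*    input alphabet {0,1} (bool), tape symbols option bool (None = blank). *)

Inductive dir := MoveL | MoveR.

(* A TM has finitely many states 'I_(n.+1); state ord0 is the start state.
   The machine halts when the transition function returns None. *)
Record tm := TM {
  tm_n : nat;
  tm_delta : 'I_tm_n.+1 -> option bool -> option ('I_tm_n.+1 * option bool * dir)
}.

(* configuration: state, left part of tape (reversed), scanned symbol, right part *)
Definition config (M : tm) := ('I_(tm_n M).+1 * seq (option bool) * option bool * seq (option bool))%type.

Definition halted (M : tm) (c : config M) : bool :=
  let: (q, _, h, _) := c in if tm_delta q h is None then true else false.

Definition step (M : tm) (c : config M) : config M :=
  let: (q, l, h, r) := c in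
  match tm_delta q h with
  | None => c
  | Some (q', w, MoveL) =>
      match l with
      | [::] => (q', [::], None, w :: r)
      | a :: l' => (q', l', a, w :: r)
      end
  | Some (q', w, MoveR) =>
      match r with
      | [::] => (q', w :: l, None, [::])
      | a :: r' => (q', w :: l, a, r')
      end
  end.

Fixpoint run (M : tm) (t : nat) (c : config M) : option (config M) :=
  if halted c then Some c else
  match t with
  | 0 => None
  | t'.+1 => run t' (step c)
  end.

Definition init (M : tm) (x : seq bool) : config M :=
  match x with
  | [::] => (ord0, [::], None, [::])
  | b :: x' => (ord0, [::], Some b, map Some x')
  end.

Fixpoint read_word (s : seq (option bool)) : seq bool :=
  match s with
  | Some b :: s' => b :: read_word s'
  | _ => [::]
  end.

Definition output (M : tm) (c : config M) : seq bool :=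
  let: (_, _, h, r) := c in read_word (h :: r).

Definition poly_time_computable (f : seq bool -> seq bool) : Prop :=
  exists (M : tm) (c d : nat), forall x : seq bool,
    exists cfg, run (c * (size x).+1 ^ d) (init M x) = Some cfg /\ output cfg = f x.

Definition poly_time_decidable (L : seq bool -> Prop) : Prop :=
  exists f, poly_time_computable f /\ forall x, L x <-> f x = [:: true].

Definition pair_enc (x y : seq bool) : seq bool :=
  flatten (map (fun b => [:: b; b]) x) ++ [:: false; true] ++ y.

Definition NP (L : seq bool -> Prop) : Prop :=
  exists V, poly_time_decidable V /\ exists c d, forall x,
    L x <-> exists y, size y <= c * (size x).+1 ^ d /\ V (pair_enc x y).

Definition coNP_poly (L : seq bool -> Prop) : Prop :=
  exists L', NP L' /\ exists (a : nat -> seq bool) (c d : nat),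
    (forall n, size (a n) <= c * n.+1 ^ d) /\
    forall x, ~ L x <-> L' (pair_enc x (a (size x))).

Definition NP_subset_coNP_poly : Prop := forall L, NP L -> coNP_poly L.

Definition param_problem := seq bool -> nat -> Prop.

Definition enc_pk (x : seq bool) (k : nat) : seq bool := pair_enc x (nseq k true).

Definition has_poly_kernel (P : param_problem) : Prop :=
  exists f, poly_time_computable f /\
  exists c d, forall x k, exists x' k',
    f (enc_pk x k) = enc_pk x' k' /\ (P x k <-> P x' k') /\
    size x' + k' <= c * k.+1 ^ d.

(* literal (v, true) = x_v, (v, false) = not x_v *)
Definition lit := (nat * bool)%type.
Definition clause := seq lit.      (* read as a set of literals *)
Definition cnf := seq clause.      (* read as a set of clauses *)

Definition is3CNF (F : cnf) : bool := all (fun C => size (undup C) <= 3) F.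
Definition is2CNF (F : cnf) : bool := all (fun C => size (undup C) <= 2) F.
Definition isHorn (F : cnf) : bool :=
  all (fun C => count (fun l : lit => l.2) (undup C) <= 1) F.

Definition reduce (F : cnf) (B : seq nat) (tau : nat -> bool) : cnf :=
  [seq [seq l <- C | l.1 \notin B] |
     C <- F & ~~ has (fun l : lit => (l.1 \in B) && (tau l.1 == l.2)) C].

Definition is_backdoor (cls : cnf -> bool) (F : cnf) (B : seq nat) : Prop :=
  forall tau : nat -> bool, cls (reduce F B tau).

Definition satisfiable (F : cnf) : Prop :=
  exists alpha : nat -> bool, all (fun C => has (fun l : lit => alpha l.1 == l.2) C) F.

Definition tok_d0 := [:: false; false; false].
Definition tok_d1 := [:: false; false; true].
Definition tok_endnum := [:: false; true; false].
Definition tok_endclause := [:: false; true; true].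
Definition tok_endformula := [:: true; false; false].
Definition tok_digit (b : bool) := if b then tok_d1 else tok_d0.

(* binary digits, most significant first, no leading zeros *)
Fixpoint bits_fuel (fuel n : nat) : seq bool :=
  match fuel with
  | 0 => [::]
  | fuel'.+1 => if n is 0 then [::] else rcons (bits_fuel fuel' n./2) (odd n)
  end.
Definition bits (n : nat) : seq bool := bits_fuel n n.

Definition enc_nat (n : nat) : seq bool := flatten (map tok_digit (bits n)) ++ tok_endnum.
Definition enc_lit (l : lit) : seq bool := tok_digit l.2 ++ enc_nat l.1.
Definition enc_clause (C : clause) : seq bool := flatten (map enc_lit C) ++ tok_endclause.
Definition enc_cnf (F : cnf) : seq bool := flatten (map enc_clause F) ++ tok_endformula.
Definition enc_inst (F : cnf) (B : seq nat) : seq bool :=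
  enc_cnf F ++ flatten (map enc_nat B).

Definition SAT3_backdoor (cls : cnf -> bool) : param_problem :=
  fun x k => exists (F : cnf) (B : seq nat),
    x = enc_inst F B /\ is3CNF F /\ uniq B /\ size B = k /\
    is_backdoor cls F B /\ satisfiable F.

Definition SAT3_Horn_backdoor := SAT3_backdoor isHorn.
Definition SAT3_2CNF_backdoor := SAT3_backdoor is2CNF.

(* Main.v *)
(* The argument of Fortnow and Santhanam is applied directly to a language L in NP.  For fixed n,
   a 3CNF formula describes the accepting runs of the verifier of L on words of length n; all its
   variables go into the backdoor.  Given t = 2 ^ e words, a binary tree of further variables,
   steered by e backdoor bits, selects one of them, and clauses (not leaf_i, or bit j = u_i j) force
   the selected word to be accepted.  After the backdoor is assigned each clause has at most two
   literals, of which at most one is positive, so it is both Horn and 2CNF.  Hence the question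
   whether one of the t words is in L becomes an instance whose parameter is poly(n) + e, and t can
   be taken larger than the bit length of its kernel.  By counting, some kernel is reached from
   tuples of nonmembers that together contain half of all nonmembers; iterating, n + 1 kernels,
   given as advice, take care of all nonmembers: x is not in L iff x belongs to a tuple whose
   kernel is in the list.

   The instance depends on the words only through t * n isolated bits.  The advice therefore also
   stores the instance as a template, and the certificate verifier only fills in bits, runs the
   kernelization and compares. *)
Require Import Defs.
From Stdlib Require Import ZArith Lia ClassicalEpsilon FunctionalExtensionality.
From mathcomp Require Import all_boot zify_ssreflect.
Set Implicit Arguments. Unset Strict Implicit. Unset Printing Implicit Defensive.
Local Open Scope nat_scope.
Local Arguments Z.add : simpl never.
Local Arguments Z.sub : simpl never.
Local Arguments Z.mul : simpl never.
Local Arguments Z.opp : simpl never.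
Local Arguments Z.of_nat : simpl never.

(** * Tapes indexed by the integers *)

(** Of the kernelization only two facts are used: its outputs are short, and equal outputs come from
    equivalent instances. Every listed kernel is reached from a tuple of nonmembers, hence is a
    no-instance, so no member of [L] can lie in a tuple with a listed kernel; this is the soundness
    of the certificates. The tuple has to outgrow the kernel while the parameter must not grow with
    the tuple. Therefore all words share one tableau, and each word occurs only in the signs of
    literals guarded by a leaf outside the backdoor. The e selector bits do enter the parameter, but
    e is only logarithmic in the tuple length. Polynomial time here means a concrete one-tape
    machine. Nothing ever computes the formula: it has to exist and be of polynomial size, so its
    clauses may be chosen by a semantic, nonconstructive criterion. What remains to be programmed is
    an interpreter that runs the kernelization machine as a subroutine; it is written for five
    stacks, and a general simulation turns it into a one-tape machine. *)

Definition tape := Z -> option bool.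

Definition upd (T : tape) (p : Z) (w : option bool) : tape :=
  fun x => if Z.eqb x p then w else T x.

Definition move (d : dir) (p : Z) : Z :=
  match d with MoveL => (p - 1)%Z | MoveR => (p + 1)%Z end.

Lemma upd_same (T : tape) p w : upd T p w p = w.
Proof. by rewrite /upd Z.eqb_refl. Qed.

Lemma upd_diff (T : tape) p w x : x <> p -> upd T p w x = T x.
Proof. by move=> neq; rewrite /upd; case: (Z.eqb_spec x p). Qed.

Lemma upd_id (T : tape) p : upd T p (T p) = T.
Proof.
by apply: functional_extensionality => x; rewrite /upd; case: (Z.eqb_spec x p) => [->|].
Qed.

Lemma upd_id_eq (T : tape) p w : T p = w -> upd T p w = T.
Proof. by move=> <-; exact: upd_id. Qed.

Definition acfg (S : Type) := (S * tape * Z)%type.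

Definition table (S : Type) := S -> option bool -> option (S * option bool * dir).

Definition astep (S : Type) (delta : table S) (c : acfg S) : acfg S :=
  let: (q, T, p) := c in
  match delta q (T p) with
  | None => c
  | Some (q', w, d) => (q', upd T p w, move d p)
  end.

Definition ahalted (S : Type) (delta : table S) (c : acfg S) : bool :=
  let: (q, T, p) := c in ~~ isSome (delta q (T p)).

Definition word_tape (x : seq bool) : tape :=
  fun z => if (z <? 0)%Z then None else nth None (map Some x) (Z.to_nat z).

Lemma word_tape_neg x z : (z < 0)%Z -> word_tape x z = None.
Proof. by rewrite /word_tape; case: Z.ltb_spec => //; lia. Qed.

Lemma word_tape_nat x i : word_tape x (Z.of_nat i) = nth None (map Some x) i.
Proof. by rewrite /word_tape; case: Z.ltb_spec => [|_]; rewrite ?Nat2Z.id //; lia. Qed.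

Section Abstraction.

Variables (M : tm) (S : Type) (delta : table S) (g : 'I_(tm_n M).+1 -> S).

Hypothesis deltaE : forall q h,
  delta (g q) h = omap (fun r => (g r.1.1, r.1.2, r.2)) (tm_delta q h).

Definition rep (c : config M) (a : acfg S) : Prop :=
  let: (q, l, h, r) := c in let: (s, T, p) := a in
  [/\ g q = s, T p = h,
      (forall i, nth None r i = T (p + 1 + Z.of_nat i)%Z)
    & (forall i, nth None l i = T (p - 1 - Z.of_nat i)%Z)].

Lemma rep_halted c a : rep c a -> halted c = ahalted delta a.
Proof.
case: c => [[[q l] h] r]; case: a => [[s T] p] [<- Th _ _] /=.
by rewrite Th deltaE; case: (tm_delta q h).
Qed.

Lemma rep_step c a : rep c a -> rep (step c) (astep delta a).
Proof.
case: c => [[[q l] h] r]; case: a => [[s T] p] [<- Th Tr Tl] /=.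
rewrite Th deltaE; case: (tm_delta q h) => [[[q' w] d]|] //=.
case: d => /=.
- case: l Tl => [|a l] Tl; split=> //.
  + by rewrite upd_diff; [move: (Tl 0) => /= ->; congr T | ]; lia.
  + move=> i; case: i => [|i] /=.
      by rewrite (_ : (_ + _)%Z = p) ?upd_same //; lia.
    rewrite upd_diff ?Tr; last lia.
    by congr T; lia.
  + move=> i; rewrite upd_diff; last lia.
    by rewrite nth_nil; move: (Tl i.+1) => /= ->; congr T; lia.
  + by rewrite upd_diff; [move: (Tl 0) => /= ->; congr T | ]; lia.
  + move=> i; case: i => [|i] /=.
      by rewrite (_ : (_ + _)%Z = p) ?upd_same //; lia.
    rewrite upd_diff ?Tr; last lia.
    by congr T; lia.
  + move=> i; rewrite upd_diff; last lia.
    by move: (Tl i.+1) => /= ->; congr T; lia.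
- case: r Tr => [|a r] Tr; split=> //.
  + by rewrite upd_diff; [move: (Tr 0) => /= ->; congr T | ]; lia.
  + move=> i; rewrite upd_diff; last lia.
    by rewrite nth_nil; move: (Tr i.+1) => /= ->; congr T; lia.
  + move=> i; case: i => [|i] /=.
      by rewrite (_ : (_ - _)%Z = p) ?upd_same //; lia.
    rewrite upd_diff ?Tl; last lia.
    by congr T; lia.
  + by rewrite upd_diff; [move: (Tr 0) => /= ->; congr T | ]; lia.
  + move=> i; rewrite upd_diff; last lia.
    by move: (Tr i.+1) => /= ->; congr T; lia.
  + move=> i; case: i => [|i] /=.
      by rewrite (_ : (_ - _)%Z = p) ?upd_same //; lia.
    rewrite upd_diff ?Tl; last lia.
    by congr T; lia.
Qed.

Lemma rep_iter n c a : rep c a -> rep (iter n (@step M) c) (iter n (astep delta) a).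
Proof. by move=> ca; elim: n => //= n; exact: rep_step. Qed.

Lemma rep_init x : rep (init M x) (g ord0, word_tape x, 0%Z).
Proof.
have T0 : word_tape x 0%Z = nth None (map Some x) 0 by rewrite -word_tape_nat.
have TS i : word_tape x (0 + 1 + Z.of_nat i)%Z = nth None (map Some x) i.+1.
  by rewrite -word_tape_nat; congr word_tape; lia.
by case: x T0 TS => [|b x] T0 TS; split=> // i; rewrite ?TS ?word_tape_neg ?nth_nil //; lia.
Qed.

Lemma step_halted (c : config M) : halted c -> step c = c.
Proof. by case: c => [[[q l] h] r] /=; case: (tm_delta q h). Qed.

Lemma iter_halted n (c : config M) : halted c -> iter n (@step M) c = c.
Proof. by move=> hc; elim: n => //= n ->; exact: step_halted. Qed.

Lemma run_iter t (c : config M) n :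
  n <= t -> halted (iter n (@step M) c) -> run t c = Some (iter n (@step M) c).
Proof.
elim: t n c => [|t IHt] [|n] c //= le_nt hc; rewrite ?hc //.
case hc': (halted c).
  by rewrite iter_halted // step_halted.
by rewrite -iterS iterSr; apply: IHt => //; rewrite -iterSr.
Qed.

Lemma iter_run t (c : config M) c' :
  run t c = Some c' -> halted c' /\ forall n, t <= n -> iter n (@step M) c = c'.
Proof.
elim: t c => [|t IHt] c /=; case: ifP => hc //.
- by case=> <-; split=> // n _; exact: iter_halted.
- by case=> <-; split=> // n _; exact: iter_halted.
move=> /IHt[hc' it]; split=> // -[|n] // le_tn.
by rewrite iterSr it.
Qed.

End Abstraction.

Lemma read_word_nth s w :
  (forall i, i < size w -> nth None s i = Some (nth false w i)) ->
  nth None s (size w) = None -> read_word s = w.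
Proof.
elim: w s => [|b w IHw] [|a s] //= sw send.
- by rewrite send.
- by move: (sw 0 isT).
- by move: (sw 0 isT) => /= ->; congr cons; apply: IHw => // i; exact: (sw i.+1).
Qed.

Lemma rep_output (M : tm) (S : Type) (g : 'I_(tm_n M).+1 -> S) c (a : acfg S) w :
  rep g c a ->
  (forall i, i < size w -> a.1.2 (a.2 + Z.of_nat i)%Z = Some (nth false w i)) ->
  a.1.2 (a.2 + Z.of_nat (size w))%Z = None -> output c = w.
Proof.
case: c => [[[q l] h] r]; case: a => [[s T] p] [_ Th Tr _] /= Tw Tend.
have Tn i : nth None (h :: r) i = T (p + Z.of_nat i)%Z.
  by case: i => [|i] /=; rewrite -?Th ?Tr; congr T; lia.
by change (read_word (h :: r) = w); apply: read_word_nth => [i ltiw|]; rewrite Tn; auto.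
Qed.

(** * Transition tables over finite state types as machines *)

Section FinTM.

Variables (S : finType) (delta : table S) (s0 : S).

(** A machine starts in [ord0], so one extra index serves as a copy of [s0]. No transition leads
    back to it, and decoding is only a left inverse of encoding. *)
Definition fin_decode (q : 'I_#|S|.+1) : S :=
  if unlift ord0 q is Some i then enum_val i else s0.

Definition fin_encode (s : S) : 'I_#|S|.+1 := lift ord0 (enum_rank s).

Definition fin_tm : tm :=
  @TM #|S| (fun q h => omap (fun r => (fin_encode r.1.1, r.1.2, r.2)) (delta (fin_decode q) h)).

Lemma fin_encodeK : cancel fin_encode fin_decode.
Proof. by move=> s; rewrite /fin_decode /fin_encode liftK enum_rankK. Qed.

Lemma fin_decode0 : fin_decode ord0 = s0.
Proof. by rewrite /fin_decode unlift_none. Qed.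

Lemma fin_tm_delta (q : 'I_(tm_n fin_tm).+1) h :
  delta (fin_decode q) h = omap (fun r => (fin_decode r.1.1, r.1.2, r.2)) (tm_delta q h).
Proof. by rewrite /=; case: (delta _ h) => [[[s w] d]|] //=; rewrite fin_encodeK. Qed.

(* The result is read from the head position up to the first blank, so junk elsewhere on the tape is harmless. *)
Lemma fin_tm_run x n T s w m :
  n <= m ->
  iter n (astep delta) (s0, word_tape x, 0%Z) = (s, T, 0%Z) ->
  ahalted delta (s, T, 0%Z) ->
  (forall i, i < size w -> T (Z.of_nat i) = Some (nth false w i)) ->
  T (Z.of_nat (size w)) = None ->
  exists cfg, run m (init fin_tm x) = Some cfg /\ output cfg = w.
Proof.
move=> le_nm run_n halt_n Tw Tend.
have := rep_iter fin_tm_delta n (rep_init (fin_decode : 'I_(tm_n fin_tm).+1 -> S) x).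
rewrite fin_decode0 run_n => rep_n.
exists (iter n (@step fin_tm) (init fin_tm x)); split.
  by apply: run_iter => //; rewrite (rep_halted fin_tm_delta rep_n).
by apply: (rep_output rep_n).
Qed.

End FinTM.

(** * Simulating five stacks on one tape *)

Definition reach (A : Type) (f : A -> A) (n : nat) (a b : A) : Prop := iter n f a = b.

Lemma reach_trans (A : Type) (f : A -> A) m n a b c :
  reach f m a b -> reach f n b c -> reach f (m + n) a c.
Proof. by rewrite /reach addnC iterD => -> ->. Qed.

Lemma reach1 (A : Type) (f : A -> A) a b : f a = b -> reach f 1 a b.
Proof. by []. Qed.

Inductive stk := sR | sZ | sV | sW | sM.

Definition stk_eq_dec (i j : stk) : {i = j} + {i <> j}.
Proof. by decide equality. Defined.

Definition stacks := (seq bool * seq bool * seq bool * seq bool * seq bool)%type.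

Definition get (j : stk) (s : stacks) : seq bool :=
  let: (r, z, v, w, m) := s in
  match j with sR => r | sZ => z | sV => v | sW => w | sM => m end.

Definition set (j : stk) (x : seq bool) (s : stacks) : stacks :=
  let: (r, z, v, w, m) := s in
  match j with
  | sR => (x, z, v, w, m) | sZ => (r, x, v, w, m) | sV => (r, z, x, w, m)
  | sW => (r, z, v, x, m) | sM => (r, z, v, w, x)
  end.

Lemma get_set_same j x s : get j (set j x s) = x.
Proof. by case: s => [[[[? ?] ?] ?] ?]; case: j. Qed.

Lemma get_set_diff i j x s : i <> j -> get i (set j x s) = get i s.
Proof. by case: s => [[[[? ?] ?] ?] ?]; case: i; case: j. Qed.

(* [Op j (Some b) k] pushes [b] on [j] and goes to [k None]; [Op j None k] pops [j] and branches on the result. *)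
Inductive instr (Q : Type) := Halt | Op (j : stk) (w : option bool) (k : option bool -> Q).
Arguments Halt {Q}.

Definition Push (Q : Type) j b (q : Q) : instr Q := Op j (Some b) (fun _ => q).
Definition Pop (Q : Type) j (k : option bool -> Q) : instr Q := Op j None k.

Definition kstep (Q : Type) (code : Q -> instr Q) (c : Q * stacks) : Q * stacks :=
  let: (q, s) := c in
  match code q with
  | Halt => c
  | Op j (Some b) k => (k None, set j (b :: get j s) s)
  | Op j None k =>
      if get j s is b :: x then (k (Some b), set j x s) else (k None, s)
  end.

(* Stack [sR] grows rightwards from cell 0; the other four grow leftwards, interleaved with
   stride 4.  Row 0 of each stack is a permanently blank sentinel, and the head rests at cell 0. *)
Definition off (j : stk) : nat :=
  match j with sR => 1 | sZ => 2 | sV => 3 | sW => 4 | sM => 5 end.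
Definition stride (j : stk) : nat := match j with sR => 1 | _ => 4 end.
Definition outd (j : stk) : dir := match j with sR => MoveR | _ => MoveL end.
Definition ind (j : stk) : dir := match j with sR => MoveL | _ => MoveR end.

Definition dz (d : dir) : Z := match d with MoveL => (-1)%Z | MoveR => 1%Z end.

Definition pos (j : stk) (r : nat) : Z :=
  match j with
  | sR => (-1 + Z.of_nat r)%Z
  | _ => (- Z.of_nat (off j) - 4 * Z.of_nat r)%Z
  end.

Lemma pos_inj i j r r' : pos i r = pos j r' -> i = j /\ r = r'.
Proof. by case: i; case: j => /= ?; try (exfalso; lia); split=> //; lia. Qed.

(** The head of a list is the top of its stack, hence the outermost row, which explains [rev]. The
    default [None] also makes all rows above the top blank, so that the first blank row marks the
    top. *)
Definition stacks_on (T : tape) (s : stacks) : Prop :=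
  forall j, T (pos j 0) = None /\
    forall r, T (pos j r.+1) = nth None (map Some (rev (get j s))) r.

Notation phE := (@Ordinal 5 0 isT).
Notation phA := (@Ordinal 5 1 isT).
Notation phB := (@Ordinal 5 2 isT).
Notation phC := (@Ordinal 5 3 isT).
Notation phD := (@Ordinal 5 4 isT).

Section Simulation.

Variables (Q : finType) (code : Q -> instr Q).

(* A state is an instruction, a phase, a number of pending blank moves and the popped bit.
   Phases: E walk home, A walk to the sentinel, B walk outwards to the first free row,
   C inspect the top row, D walk back to the sentinel. *)
Definition sim_state := (Q * 'I_5 * 'I_6 * option bool)%type.

Definition sim_dir (ph : 'I_5) (j : stk) : dir :=
  match val ph with 0 => MoveR | 1 => MoveL | 2 => outd j | _ => ind j end.

Definition st (q : Q) (ph : 'I_5) (c : nat) (res : option bool) : sim_state :=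
  (q, ph, inord c, res).

Definition sim_act (q : Q) (ph : 'I_5) (res : option bool) (j : stk) (w : option bool)
    (k : option bool -> Q) (h : option bool) : sim_state * option bool * dir :=
  match val ph with
  | 0 => (st q phA (off j).-1 None, h, MoveL)
  | 1 => (st q phB (stride j).-1 None, h, outd j)
  | 2 => match h with
         | Some _ => (st q phB (stride j).-1 None, h, outd j)
         | None => match w with
                   | Some _ => (st q phD (stride j).-1 None, w, ind j)
                   | None => (st q phC (stride j).-1 None, None, ind j)
                   end
         end
  | 3 => match h with
         | Some _ => (st q phD (stride j).-1 h, None, ind j)
         | None => (st (k None) phE (off j).-1 None, None, MoveR)
         end
  | _ => match h with
         | Some _ => (st q phD (stride j).-1 res, h, ind j)
         | None => (st (k res) phE (off j).-1 None, None, MoveR)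
         end
  end.

Definition sim_table : table sim_state := fun s h =>
  let: (q, ph, c, res) := s in
  match nat_of_ord c with
  | c'.+1 => Some (st q ph c' res, h,
               match code q with Halt => MoveR | Op j _ _ => sim_dir ph j end)
  | 0 => match code q with
         | Halt => None
         | Op j w k => Some (sim_act q ph res j w k h)
         end
  end.

Local Notation sstep := (astep sim_table).

Lemma sim_stepS q ph c res T p : c.+1 < 6 ->
  sstep (st q ph c.+1 res, T, p) =
  (st q ph c res, T, move (match code q with Halt => MoveR | Op j _ _ => sim_dir ph j end) p).
Proof. by move=> lt6; rewrite /= /sim_table /st /= inordK // upd_id. Qed.

Lemma sim_step0 q ph res T p j w k : code q = Op j w k ->
  sstep (st q ph 0 res, T, p) =
  let: (s', w', d) := sim_act q ph res j w k (T p) in (s', upd T p w', move d p).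
Proof.
by move=> codeq; rewrite /= /sim_table /st inordK // codeq; case: (sim_act _ _ _ _ _ _ _) => [[]].
Qed.

Lemma sim_moves q ph c res T p d : c < 6 ->
  d = (match code q with Halt => MoveR | Op j _ _ => sim_dir ph j end) ->
  reach sstep c (st q ph c res, T, p) (st q ph 0 res, T, (p + Z.of_nat c * dz d)%Z).
Proof.
move=> + dE; elim: c p => [|c IHc] p lt6.
  by rewrite (_ : (_ + _)%Z = p) //; lia.
rewrite /reach iterSr sim_stepS // -dE IHc; last by lia.
by congr (_, _); case: (d) => /=; lia.
Qed.

Lemma sim_home q T (c : nat) : c < 6 ->
  reach sstep c (st q phE c None, T, (- Z.of_nat c)%Z) (st q phE 0 None, T, 0%Z).
Proof.
move=> lt6; have -> : 0%Z = (- Z.of_nat c + Z.of_nat c * dz MoveR)%Z by rewrite /=; lia.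
by apply: sim_moves => //; case: (code q).
Qed.

Section OneInstr.

Variables (q : Q) (j : stk) (w : option bool) (k : option bool -> Q).
Hypothesis codeq : code q = Op j w k.

Lemma stride_gt0 : 0 < stride j. Proof. by case: j. Qed.

Lemma sim_leg ph c res T p d : c = (stride j).-1 ->
  d = sim_dir ph j ->
  reach sstep c (st q ph c res, T, move d p)
    (st q ph 0 res, T, (p + Z.of_nat (stride j) * dz d)%Z).
Proof.
move=> -> dE.
have -> : (p + Z.of_nat (stride j) * dz d = move d p + Z.of_nat (stride j).-1 * dz d)%Z.
  by rewrite -{1}(prednK stride_gt0); case: (d) => /=; lia.
by apply: sim_moves; [case: (j) | rewrite codeq].
Qed.

Lemma posS r : pos j r.+1 = (pos j r + Z.of_nat (stride j) * dz (outd j))%Z.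
Proof. by case: (j) => /=; lia. Qed.

Lemma posP r : pos j r = (pos j r.+1 + Z.of_nat (stride j) * dz (ind j))%Z.
Proof. by case: (j) => /=; lia. Qed.

Lemma sim_leave T :
  reach sstep (off j + stride j) (st q phE 0 None, T, 0%Z) (st q phB 0 None, T, pos j 1).
Proof.
have -> : off j + stride j = 1 + ((off j).-1 + (1 + (stride j).-1)) by case: (j).
apply: (reach_trans (b := (st q phA (off j).-1 None, T, (-1)%Z))).
  by apply: reach1; rewrite (sim_step0 _ _ _ _ codeq) /= upd_id.
apply: (reach_trans (b := (st q phA 0 None, T, pos j 0))).
  have -> : pos j 0 = (-1 + Z.of_nat (off j).-1 * dz MoveL)%Z by case: (j).
  by apply: sim_moves; [case: (j) | rewrite codeq].
apply: (reach_trans (b := (st q phB (stride j).-1 None, T, move (outd j) (pos j 0)))).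
  by apply: reach1; rewrite (sim_step0 _ _ _ _ codeq) /= upd_id.
by rewrite posS; exact: sim_leg.
Qed.

Lemma sim_outward T r n :
  (forall i, r <= i < r + n -> T (pos j i) != None) ->
  reach sstep (n * stride j) (st q phB 0 None, T, pos j r) (st q phB 0 None, T, pos j (r + n)).
Proof.
elim: n r => [|n IHn] r Tr; first by rewrite addn0.
rewrite mulSn addnS -addSn; apply: reach_trans; last by apply: IHn => i ?; apply: Tr; lia.
rewrite -(prednK stride_gt0) -add1n.
apply: (reach_trans (b := (st q phB (stride j).-1 None, T, move (outd j) (pos j r)))).
  apply: reach1; rewrite (sim_step0 _ _ _ _ codeq) /=.
  have /Tr : r <= r < r + n.+1 by lia.
  by case Tp: (T (pos j r)) => [b|] //= _; rewrite upd_id_eq.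
by rewrite posS; exact: sim_leg.
Qed.

Lemma sim_inward T r res :
  (forall i, 0 < i <= r -> T (pos j i) != None) ->
  reach sstep (r * stride j) (st q phD 0 res, T, pos j r) (st q phD 0 res, T, pos j 0).
Proof.
elim: r => [|r IHr] Tr //.
rewrite mulSn; apply: reach_trans; last by apply: IHr => i ?; apply: Tr; lia.
rewrite -{1}(prednK stride_gt0) -add1n.
apply: (reach_trans (b := (st q phD (stride j).-1 res, T, move (ind j) (pos j r.+1)))).
  apply: reach1; rewrite (sim_step0 _ _ _ _ codeq) /=.
  have /Tr : 0 < r.+1 <= r.+1 by lia.
  by case Tp: (T (pos j r.+1)) => [b|] //= _; rewrite upd_id_eq.
by rewrite (posP r); exact: sim_leg.
Qed.

Lemma move_off : move MoveR (pos j 0) = (- Z.of_nat (off j).-1)%Z.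
Proof. by case: (j). Qed.

Lemma sim_return T res : T (pos j 0) = None ->
  reach sstep (off j) (st q phD 0 res, T, pos j 0) (st (k res) phE 0 None, T, 0%Z).
Proof.
move=> T0; have -> : off j = 1 + (off j).-1 by case: (j).
apply: (reach_trans (b := (st (k res) phE (off j).-1 None, T, (- Z.of_nat (off j).-1)%Z))).
  by apply: reach1; rewrite (sim_step0 _ _ _ _ codeq) /sim_act /= T0 -/(move MoveR _) move_off upd_id_eq.
by apply: sim_home; case: (j).
Qed.

Lemma sim_return_empty T : T (pos j 0) = None ->
  reach sstep (off j) (st q phC 0 None, T, pos j 0) (st (k None) phE 0 None, T, 0%Z).
Proof.
move=> T0; have -> : off j = 1 + (off j).-1 by case: (j).
apply: (reach_trans (b := (st (k None) phE (off j).-1 None, T, (- Z.of_nat (off j).-1)%Z))).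
  by apply: reach1; rewrite (sim_step0 _ _ _ _ codeq) /sim_act /= T0 -/(move MoveR _) move_off upd_id_eq.
by apply: sim_home; case: (j).
Qed.

End OneInstr.

Lemma stacks_on_some T s j r :
  stacks_on T s -> (T (pos j r.+1) != None) = (r < size (get j s)).
Proof.
move=> /(_ j)[_ ->]; case: ltnP => [lt|ge].
  by rewrite (nth_map false) ?size_rev.
by rewrite nth_default // size_map size_rev.
Qed.

Lemma nth_rcons_upd (x : seq bool) b r :
  nth None (map Some (rcons x b)) r = if r == size x then Some b else nth None (map Some x) r.
Proof.
rewrite map_rcons nth_rcons size_map; case: ltngtP => // lt.
by rewrite nth_default // size_map ltnW.
Qed.

Lemma stacks_on_push T s j b : stacks_on T s ->
  stacks_on (upd T (pos j (size (get j s)).+1) (Some b)) (set j (b :: get j s) s).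
Proof.
move=> Ts i; have [Ti0 TiS] := Ts i; split=> [|r].
  by rewrite upd_diff // => /pos_inj[].
case: (stk_eq_dec i j) => [ij|neq]; last first.
  by rewrite upd_diff ?get_set_diff // => /pos_inj[].
rewrite -ij get_set_same rev_cons nth_rcons_upd size_rev; case: eqP => [->|neq].
  by rewrite upd_same.
by rewrite upd_diff // => /pos_inj[_ []].
Qed.

Lemma stacks_on_pop T s j b x : stacks_on T s -> get j s = b :: x ->
  stacks_on (upd T (pos j (size x).+1) None) (set j x s).
Proof.
move=> Ts sj i; have [Ti0 TiS] := Ts i; split=> [|r].
  by rewrite upd_diff // => /pos_inj[].
case: (stk_eq_dec i j) => [ij|neq]; last first.
  by rewrite upd_diff ?get_set_diff // => /pos_inj[].
rewrite -ij get_set_same; case: (eqVneq r (size x)) => [->|neq].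
  by rewrite upd_same nth_default // size_map size_rev.
rewrite upd_diff; last by move=> /pos_inj[_ []]; exact/eqP.
by rewrite TiS ij sj rev_cons nth_rcons_upd size_rev (negPf neq).
Qed.

(** An instruction is a round trip from cell 0 to the top of one stack, with at most 5 cells to the
    sentinel and 4 cells per row each way. *)
Lemma sim_instr T s q j w k : code q = Op j w k -> stacks_on T s ->
  exists N T', let: (q', s') := kstep code (q, s) in
  [/\ N <= 20 * (size (get j s)).+1,
      reach sstep N (st q phE 0 None, T, 0%Z) (st q' phE 0 None, T', 0%Z)
    & stacks_on T' s'].
Proof.
move=> codeq Ts; set h := size (get j s).
have Tsome i : 1 <= i < 1 + h -> T (pos j i) != None.
  by case: i => [|i] // ?; rewrite (stacks_on_some j i Ts) -/h; lia.
have T0 : T (pos j 0) = None by case: (Ts j).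
have Th : T (pos j h.+1) = None.
  by apply/eqP; rewrite -[_ == _]negbK (stacks_on_some j h Ts) ltnn.
have offle : off j <= 5 by case: (j).
have strle : stride j <= 4 by case: (j).
have goto_top := reach_trans (sim_leave codeq T) (sim_outward codeq Tsome).
case: w codeq goto_top => [b|] codeq goto_top.
- set T' := upd T (pos j h.+1) (Some b).
  have T's : stacks_on T' (set j (b :: get j s) s) by exact: stacks_on_push.
  exists (off j + stride j + h * stride j + (1 + (stride j).-1) + h * stride j + off j), T'.
  rewrite /= codeq /=; split=> //; first by case: (j); rewrite /=; lia.
  apply: reach_trans (sim_return codeq _ _); last by case: (T's j).
  apply: (reach_trans (b := (st q phD 0 None, T', pos j h))); last first.
    apply: (sim_inward codeq) => // i ltih; case: i ltih => [|i] // ltih.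
    by rewrite (stacks_on_some j i T's) get_set_same /=; lia.
  apply: (reach_trans goto_top); rewrite (posP j h).
  apply: reach_trans (sim_leg codeq _ _ _ _ _); [apply: reach1 | by [] | by []].
  by rewrite (sim_step0 _ _ _ _ codeq) /sim_act /= Th.
case sj: (get j s) @h Tsome Th goto_top => [|b x] h Tsome Th goto_top.
- exists (off j + stride j + h * stride j + (1 + (stride j).-1) + off j), T.
  rewrite /= codeq /= sj; split=> //; first by case: (j); rewrite /=; lia.
  apply: reach_trans (sim_return_empty codeq T0).
  apply: (reach_trans goto_top); rewrite (posP j 0).
  apply: reach_trans (sim_leg codeq _ _ _ _ _); [apply: reach1 | by [] | by []].
  by rewrite (sim_step0 _ _ _ _ codeq) /sim_act /= Th upd_id_eq.
set T' := upd T (pos j h) None.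
have T's : stacks_on T' (set j x s) by exact: stacks_on_pop sj.
exists (off j + stride j + h * stride j + (1 + (stride j).-1) + (1 + (stride j).-1)
        + size x * stride j + off j), T'.
rewrite /= codeq /= sj; split=> //; first by rewrite /h /=; case: (j); rewrite /=; lia.
apply: reach_trans (sim_return codeq _ _); last by case: (T's j).
apply: (reach_trans (b := (st q phD 0 (Some b), T', pos j (size x)))); last first.
  apply: (sim_inward codeq) => // i ltih; case: i ltih => [|i] // ltih.
  by rewrite (stacks_on_some j i T's) get_set_same /=; lia.
apply: (reach_trans (b := (st q phC 0 None, T, pos j h))).
  apply: (reach_trans goto_top); rewrite (posP j h).
  apply: reach_trans (sim_leg codeq _ _ _ _ _); [apply: reach1 | by [] | by []].
  by rewrite (sim_step0 _ _ _ _ codeq) /sim_act /= Th upd_id_eq.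
rewrite (posP j (size x)) -/h.
apply: reach_trans (sim_leg codeq _ _ _ _ _); [apply: reach1 | by [] | by []].
rewrite (sim_step0 _ _ _ _ codeq) /sim_act /=.
have [_ ->] := Ts j; rewrite sj rev_cons nth_rcons_upd size_rev eqxx /T' /h /=.
by [].
Qed.

Lemma kstep_size q s j w k i : code q = Op j w k ->
  size (get i (kstep code (q, s)).2) <= (size (get i s)).+1.
Proof.
move=> codeq; rewrite /= codeq; case: w codeq => [b|] codeq /=.
  case: (stk_eq_dec i j) => [->|neq]; first by rewrite get_set_same.
  by rewrite get_set_diff.
case sj: (get j s) => [|b x] //=.
case: (stk_eq_dec i j) => [->|neq]; first by rewrite get_set_same sj /=; lia.
by rewrite get_set_diff.
Qed.

(** Each instruction raises a stack by at most one, so every round trip stays below height m + n. *)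
Lemma sim_run n m T s q : stacks_on T s -> (forall i, size (get i s) <= m) ->
  exists N T', let: (q', s') := iter n (kstep code) (q, s) in
  [/\ N <= n * (20 * (m + n).+1),
      reach sstep N (st q phE 0 None, T, 0%Z) (st q' phE 0 None, T', 0%Z)
    & stacks_on T' s'].
Proof.
elim: n m T s q => [|n IHn] m T s q Ts sm; first by exists 0, T.
rewrite iterSr; case codeq: (code q) => [|j w k].
  have [N [T' H]] := IHn m T s q Ts sm; exists N, T'; rewrite /= codeq.
  by case: (iter n _ _) H => [q' s'] [? ? ?]; split=> //; lia.
have [N1 [T1]] := sim_instr codeq Ts.
case E: (kstep code (q, s)) => [q1 s1] [leN1 reach1 T1s1].
have s1m i : size (get i s1) <= m.+1.
  by have := kstep_size s i codeq; rewrite E /= => /leq_trans-> //; rewrite ltnS.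
have [N2 [T2]] := IHn m.+1 T1 s1 q1 T1s1 s1m.
case: (iter n _ _) => [q2 s2] [leN2 reach2 T2s2].
exists (N1 + N2), T2; split=> //; last exact: reach_trans reach1 reach2.
by have := sm j; nia.
Qed.

(** The input tape already is a stack configuration: the word occupies [sR] with its last symbol on
    top. *)
Lemma stacks_on_init x : stacks_on (word_tape x) (rev x, [::], [::], [::], [::]).
Proof.
have Tpos r : word_tape x (pos sR r.+1) = nth None (map Some x) r.
  by rewrite -word_tape_nat; congr word_tape; rewrite /pos; lia.
by case; split=> [|r]; rewrite /get ?revK ?Tpos ?nth_nil ?word_tape_neg // /pos /off; lia.
Qed.

Definition kinit (x : seq bool) : stacks := (rev x, [::], [::], [::], [::]).

(** Read from bottom to top, [sR] fills the cells from 0 to the right, so a final [rev (f x)] spells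
    [f x] starting at the resting head. The other stacks lie to the left, where no output is
    read. *)
Theorem stack_machine_poly_time (q0 : Q) (f : seq bool -> seq bool) (c d : nat) :
  (forall x, exists n q s, [/\ n <= c * (size x).+1 ^ d,
     iter n (kstep code) (q0, kinit x) = (q, s), code q = Halt & get sR s = rev (f x)]) ->
  poly_time_computable f.
Proof.
move=> f_run; exists (fin_tm sim_table (st q0 phE 0 None)).
exists (40 * c.+1 * c.+1), (d + d).+1 => x.
have [n [q [s [le_n run_n codeq sR_f]]]] := f_run x.
have kx i : size (get i (kinit x)) <= size x by case: i; rewrite /= ?size_rev.
have [N [T']] := sim_run n q0 (stacks_on_init x) kx.
rewrite -/(kinit x) run_n => -[leN reachN T's].
have T'R r : T' (Z.of_nat r) = nth None (map Some (f x)) r.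
  by have [_ /(_ r)] := T's sR; rewrite sR_f revK => <-; congr T'; rewrite /pos; lia.
apply: (fin_tm_run (n := N) (s := st q phE 0 None) (T := T')) => //.
- apply: (leq_trans leN).
  have X0 : 0 < (size x).+1 ^ d by rewrite expn_gt0.
  rewrite expnS expnD; set X := (size x).+1 ^ d in le_n X0 *.
  have : n * (20 * (size x + n).+1) <= (c * X) * (20 * (size x + c * X).+1) by nia.
  by move/leq_trans; apply; nia.
- by rewrite /= inordK // codeq.
- by move=> i ltif; rewrite T'R (nth_map false).
- by rewrite T'R nth_default // size_map.
Qed.

End Simulation.

(** * The verifying program *)

Lemma fun_choice (A B : Type) (P : A -> B -> Prop) :
  (forall x, exists y, P x y) -> exists g, forall x, P x (g x).
Proof.
move=> H; exists (fun x => proj1_sig (constructive_indefinite_description _ (H x))).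
by move=> x; exact: proj2_sig (constructive_indefinite_description _ (H x)).
Qed.

(** The first component comes out reversed, as happens when one stack is emptied onto another. *)
Fixpoint unpair (z acc : seq bool) : option (seq bool * seq bool) :=
  match z with
  | a :: b :: z' =>
      if a == b then unpair z' (a :: acc) else if b then Some (acc, z') else None
  | _ => None
  end.

(* Template opcodes: [0 b] emits [b]; [10] opens a block and pops its mode from [y];
   [110] is a hole, emitting twice a bit popped from [x] (mode true) or [y] (mode false);
   [111] ends the template.  The output accumulates in reverse. *)
Fixpoint gen (v : seq bool) (m : bool) (x y w : seq bool) :=
  match v with
  | false :: b :: v' => gen v' m x y (b :: w)
  | true :: false :: v' => if y is m' :: y' then gen v' m' x y' w else None
  | true :: true :: false :: v' =>
      if m then (if x is b :: x' then gen v' m x' y (b :: b :: w) else None)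
      else (if y is b :: y' then gen v' m x y' (b :: b :: w) else None)
  | true :: true :: true :: v' => Some (v', x, y, w)
  | _ => None
  end.

(* A list entry [b1 ... bk] is coded [1 b1 ... 1 bk 0]. *)
Fixpoint skip (v : seq bool) : option (seq bool) :=
  match v with
  | false :: v' => Some v'
  | true :: _ :: v' => skip v'
  | _ => None
  end.

Fixpoint matches (v o : seq bool) : bool :=
  match v with
  | false :: _ => o == [::]
  | true :: b :: v' => if o is b' :: o' then (b == b') && matches v' o' else false
  | _ => false
  end.

(** The certificate points at a list entry in unary: every [false] skips one entry, [true]
    compares. *)
Fixpoint lookup (y v o : seq bool) : bool :=
  match y with
  | true :: _ => matches v o
  | false :: y' => if skip v is Some v' then lookup y' v' o else false
  | [::] => false
  end.

(** Undoing the outer pairing reverses the inner pair, hence [rev u]; undoing the inner one leaves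
    the input reversed in [x]. For a nonempty input the test [x' == [::]] ensures that the
    certificate has placed it in a block of the tuple. *)
Definition verify (f : seq bool -> seq bool) (z : seq bool) : bool :=
  if unpair z [::] is Some (u, y) then
    if unpair (rev u) [::] is Some (x, v) then
      if gen v false x y [::] is Some (v', x', y', w) then
        (x' == [::]) && lookup y' v' (f (rev w))
      else false
    else false
  else false.

Notation lb i := (@Ordinal 40 i isT).

(** With [false] as the code of a blank, popping a blank and popping an exhausted stack lead to the
    same branch, just as a tape is blank beyond its stored part. *)
Definition cell_code (a : option bool) : seq bool :=
  if a is Some b then [:: true; b] else [:: false].
Definition cells (s : seq (option bool)) : seq bool := flatten (map cell_code s).

Section Program.

Variables (M : tm) (f : seq bool -> seq bool) (c d : nat).

Definition pstate := ('I_40 * option bool * bool * 'I_(tm_n M).+1)%type.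

(* Labels: 0-1 reverse the input onto [sZ]; 2-4 and 7-9 undo the two pairings, 5-6 reversing in
   between; 10-17 run the template; 18-21 load the result as a tape on [sM]; 23-27 and 29 run [M],
   with [sW] and [sM] holding the two halves of its tape and the control holding the scanned cell;
   28, 22, 30-34 search the list; 35-37 answer. *)
Definition code (q : pstate) : instr pstate :=
  let: (l, h, m, s) := q in
  let rej : pstate := (lb 36, None, false, s) in
  let bit := if h is Some b then b else false in
  let fetch (m' : bool) s' : pstate := if m' then (lb 23, None, false, s') else (lb 25, None, false, s') in
  let cmp := Pop sZ (fun r => if r is Some b then
                 (if b then (lb 30, h, false, s) else (lb 22, h, false, s)) else rej) in
  match val l with
  | 0 => Pop sR (fun r => if r is Some _ then (lb 1, r, false, s) else (lb 2, None, false, s))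
  | 1 => Push sZ bit (lb 0, None, false, s)
  | 2 => Pop sZ (fun r => if r is Some _ then (lb 3, r, false, s) else rej)
  | 3 => Pop sZ (fun r => if r is Some b then
           (if bit == b then (lb 4, h, false, s)
            else if b then (lb 5, None, false, s) else rej) else rej)
  | 4 => Push sR bit (lb 2, None, false, s)
  | 5 => Pop sR (fun r => if r is Some _ then (lb 6, r, false, s) else (lb 7, None, false, s))
  | 6 => Push sV bit (lb 5, None, false, s)
  | 7 => Pop sV (fun r => if r is Some _ then (lb 8, r, false, s) else rej)
  | 8 => Pop sV (fun r => if r is Some b then
           (if bit == b then (lb 9, h, false, s)
            else if b then (lb 10, None, false, s) else rej) else rej)
  | 9 => Push sR bit (lb 7, None, false, s)
  | 10 => Pop sV (fun r => if r is Some b then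
           (if b then (lb 12, None, m, s) else (lb 11, None, m, s)) else rej)
  | 11 => Pop sV (fun r => if r is Some _ then (lb 13, r, m, s) else rej)
  | 12 => Pop sV (fun r => if r is Some b then
           (if b then (lb 15, None, m, s) else (lb 14, None, m, s)) else rej)
  | 13 => Push sW bit (lb 10, None, m, s)
  | 14 => Pop sZ (fun r => if r is Some b then (lb 10, None, b, s) else rej)
  | 15 => Pop sV (fun r => if r is Some b then
           (if b then (lb 18, None, m, s) else (lb 16, None, m, s)) else rej)
  | 16 => Pop (if m then sR else sZ) (fun r => if r is Some _ then (lb 17, r, m, s) else rej)
  | 17 => Push sW bit (lb 13, h, m, s)
  | 18 => Pop sR (fun r => if r is Some _ then rej else (lb 19, None, false, s))
  | 19 => Pop sW (fun r => if r is Some _ then (lb 20, r, false, s) else (lb 23, None, false, s))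
  | 20 => Push sM bit (lb 21, None, false, s)
  | 21 => Push sM true (lb 19, None, false, s)
  | 22 => Pop sV (fun r => if r is Some b then
           (if b then (lb 31, h, false, s) else (lb 28, h, false, s)) else rej)
  | 23 => Pop sM (fun r => if r is Some true then (lb 24, None, false, s) else (lb 29, None, false, s))
  | 24 => Pop sM (fun r => if r is Some _ then (lb 29, r, false, s) else rej)
  | 25 => Pop sW (fun r => if r is Some true then (lb 26, None, false, s) else (lb 29, None, false, s))
  | 26 => Pop sW (fun r => if r is Some _ then (lb 29, r, false, s) else rej)
  | 27 => Push (if m then sW else sM) true (fetch m s)
  | 28 => cmp
  | 29 => match tm_delta s h with
          | None => cmp
          | Some (s', w, MoveL) => if w is Some b then Push sM b (lb 27, None, false, s')
                                   else Push sM false (fetch false s')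
          | Some (s', w, MoveR) => if w is Some b then Push sW b (lb 27, None, true, s')
                                   else Push sW false (fetch true s')
          end
  | 30 => Pop sV (fun r => if r is Some b then
           (if b then (lb 32, h, false, s)
            else if h is None then (lb 35, None, false, s) else rej) else rej)
  | 31 => Pop sV (fun r => if r is Some _ then (lb 22, h, false, s) else rej)
  | 32 => Pop sV (fun r => if r is Some b then
           (if h == Some b then (lb 33, None, false, s) else rej) else rej)
  | 33 => Pop sM (fun r => if r is Some true then (lb 34, None, false, s) else (lb 30, None, false, s))
  | 34 => Pop sM (fun r => if r is Some _ then (lb 30, r, false, s) else rej)
  | 35 => Push sR true (lb 37, None, false, s)
  | 36 => Push sR false (lb 37, None, false, s)
  | _ => Halt
  end.

Local Notation ks := (kstep code).

(** A rejection may leave junk below its [false]; the output then still differs from [[:: true]].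
    Acceptance has to find [sR] empty, which label 18 checks. *)
Definition verdict (b : bool) (R : seq bool) : Prop :=
  if b then R = [:: true] else exists R', R = false :: R'.

Definition decides (cfg : pstate * stacks) (n : nat) (b : bool) : Prop :=
  exists k q s, [/\ k <= n, reach ks k cfg (q, s), code q = Halt & verdict b (get sR s)].

Lemma decides_reach m n cfg cfg' b :
  reach ks m cfg cfg' -> decides cfg' n b -> decides cfg (m + n) b.
Proof.
move=> r [k [q [s [le_kn r' hq vb]]]]; exists (m + k), q, s; split=> //; first lia.
exact: reach_trans r r'.
Qed.

Lemma decides_leq m n cfg b : m <= n -> decides cfg m b -> decides cfg n b.
Proof. by move=> le [k [q [s [? ? ? ?]]]]; exists k, q, s; split=> //; exact: leq_trans le. Qed.

Lemma decides_rej s S n : 0 < n -> decides (lb 36, None, false, s, S) n false.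
Proof.
case: S => [[[[R Z] V] W] X] n_gt0.
by exists 1, (lb 37, None, false, s), (false :: R, Z, V, W, X); split=> //; exists R.
Qed.

Lemma decides_step_rej m n cfg s S :
  reach ks m cfg (lb 36, None, false, s, S) -> m < n -> decides cfg n false.
Proof.
move=> r lt_mn; apply: (decides_leq lt_mn); rewrite -addn1.
by apply: decides_reach r _; exact: decides_rej.
Qed.

Lemma load_run s R Z V W X :
  reach ks ((size R).*2.+1) (lb 0, None, false, s, (R, Z, V, W, X))
    (lb 2, None, false, s, ([::], catrev R Z, V, W, X)).
Proof.
elim: R Z => [|b R IHR] Z; first by exact: reach1.
rewrite (_ : _.+1 = 2 + (size R).*2.+1); last by rewrite /= doubleS; lia.
by apply: reach_trans (IHR _).
Qed.

Lemma swap_run s R Z V W X :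
  reach ks ((size R).*2.+1) (lb 5, None, false, s, (R, Z, V, W, X))
    (lb 7, None, false, s, ([::], Z, catrev R V, W, X)).
Proof.
elim: R V => [|b R IHR] V; first by exact: reach1.
rewrite (_ : _.+1 = 2 + (size R).*2.+1); last by rewrite /= doubleS; lia.
by apply: reach_trans (IHR _).
Qed.

Lemma unpair_run_Z s Z R V W X :
  match unpair Z R with
  | None => decides (lb 2, None, false, s, (R, Z, V, W, X)) (3 * (size Z).+1) false
  | Some (R', Z') => exists2 n, n <= 3 * (size Z).+1 &
      reach ks n (lb 2, None, false, s, (R, Z, V, W, X)) (lb 5, None, false, s, (R', Z', V, W, X))
  end.
Proof.
have [N] := ubnP (size Z); elim: N Z R => // N IHN [|a [|b Z]] R /=.
- by move=> _; apply: (@decides_step_rej 1); first exact: reach1.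
- by move=> _; apply: (@decides_step_rej 2).
move=> ltN; case: (a =P b) => [<-|neq].
  have r : reach ks 3 (lb 2, None, false, s, (R, [:: a, a & Z], V, W, X))
             (lb 2, None, false, s, (a :: R, Z, V, W, X)).
    by rewrite /reach /= eqxx.
  have := IHN Z (a :: R); case: unpair => [[R' Z']|] IH.
    have [|n le_n rn] := IH; first lia.
    by exists (3 + n); [lia | exact: reach_trans r rn].
  by apply: decides_leq (decides_reach r (IH _)); lia.
case: b neq ltN => neq ltN.
  exists 2; first lia.
  by case: a neq ltN.
apply: (@decides_step_rej 2); last lia.
by case: a neq ltN.
Qed.

Lemma unpair_run_V s Z R V W X :
  match unpair V R with
  | None => decides (lb 7, None, false, s, (R, Z, V, W, X)) (3 * (size V).+1) false
  | Some (R', V') => exists2 n, n <= 3 * (size V).+1 &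
      reach ks n (lb 7, None, false, s, (R, Z, V, W, X)) (lb 10, None, false, s, (R', Z, V', W, X))
  end.
Proof.
have [N] := ubnP (size V); elim: N V R => // N IHN [|a [|b V]] R /=.
- by move=> _; apply: (@decides_step_rej 1); first exact: reach1.
- by move=> _; apply: (@decides_step_rej 2).
move=> ltN; case: (a =P b) => [<-|neq].
  have r : reach ks 3 (lb 7, None, false, s, (R, Z, [:: a, a & V], W, X))
             (lb 7, None, false, s, (a :: R, Z, V, W, X)).
    by rewrite /reach /= eqxx.
  have := IHN V (a :: R); case: unpair => [[R' V']|] IH.
    have [|n le_n rn] := IH; first lia.
    by exists (3 + n); [lia | exact: reach_trans r rn].
  by apply: decides_leq (decides_reach r (IH _)); lia.
case: b neq ltN => neq ltN.
  exists 2; first lia.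
  by case: a neq ltN.
apply: (@decides_step_rej 2); last lia.
by case: a neq ltN.
Qed.

Lemma gen_run s m R Z V W X :
  match gen V m R Z W with
  | None => decides (lb 10, None, m, s, (R, Z, V, W, X)) (6 * (size V).+1) false
  | Some (V', R', Z', W') => exists2 n, n <= 6 * (size V).+1 & exists m',
      reach ks n (lb 10, None, m, s, (R, Z, V, W, X)) (lb 18, None, m', s, (R', Z', V', W', X))
  end.
Proof.
have [N] := ubnP (size V).
elim: N V m R Z W => // N IHN [|[] [|[] V]] m R Z W.
- by move=> _; apply: (@decides_step_rej 1); first exact: reach1.
- by move=> _; apply: (@decides_step_rej 2).
- case: V => [|[] V] /= ltN.
  + by apply: (@decides_step_rej 3); [case: m | lia].
  + by exists 3; [lia | exists m].
  case: m => /=.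
    case: R => [|b R]; first by apply: (@decides_step_rej 4); [ | lia].
    have r : reach ks 6 (lb 10, None, true, s, (b :: R, Z, [:: true, true, false & V], W, X))
               (lb 10, None, true, s, (R, Z, V, b :: b :: W, X)) by [].
    have := IHN V true R Z (b :: b :: W); case: gen => [[[[V' R'] Z'] W']|] IH.
      have [|n le_n [m' rn]] := IH; first lia.
      by exists (6 + n); [lia | exists m'; exact: reach_trans r rn].
    by apply: decides_leq (decides_reach r (IH _)); lia.
  case: Z => [|b Z]; first by apply: (@decides_step_rej 4); [ | lia].
  have r : reach ks 6 (lb 10, None, false, s, (R, b :: Z, [:: true, true, false & V], W, X))
             (lb 10, None, false, s, (R, Z, V, b :: b :: W, X)) by [].
  have := IHN V false R Z (b :: b :: W); case: gen => [[[[V' R'] Z'] W']|] IH.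
    have [|n le_n [m' rn]] := IH; first lia.
    by exists (6 + n); [lia | exists m'; exact: reach_trans r rn].
  by apply: decides_leq (decides_reach r (IH _)); lia.
- move=> /= ltN; case: Z => [|m' Z]; first by apply: (@decides_step_rej 3); [ | lia].
  have r : reach ks 3 (lb 10, None, m, s, (R, m' :: Z, [:: true, false & V], W, X))
             (lb 10, None, m', s, (R, Z, V, W, X)) by [].
  have := IHN V m' R Z W; case: gen => [[[[V' R'] Z'] W']|] IH.
    have [|n le_n [m'' rn]] := IH; first lia.
    by exists (3 + n); [lia | exists m''; exact: reach_trans r rn].
  by apply: decides_leq (decides_reach r (IH _)); lia.
- by move=> _; apply: (@decides_step_rej 2).
- move=> /= ltN.
  have r : reach ks 3 (lb 10, None, m, s, (R, Z, [:: false, true & V], W, X))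
             (lb 10, None, m, s, (R, Z, V, true :: W, X)) by [].
  have := IHN V m R Z (true :: W); case: gen => [[[[V' R'] Z'] W']|] IH.
    have [|n le_n [m' rn]] := IH; first lia.
    by exists (3 + n); [lia | exists m'; exact: reach_trans r rn].
  by apply: decides_leq (decides_reach r (IH _)); lia.
- move=> /= ltN.
  have r : reach ks 3 (lb 10, None, m, s, (R, Z, [:: false, false & V], W, X))
             (lb 10, None, m, s, (R, Z, V, false :: W, X)) by [].
  have := IHN V m R Z (false :: W); case: gen => [[[[V' R'] Z'] W']|] IH.
    have [|n le_n [m' rn]] := IH; first lia.
    by exists (3 + n); [lia | exists m'; exact: reach_trans r rn].
  by apply: decides_leq (decides_reach r (IH _)); lia.
Qed.

(** [sW] holds the generated text in reverse, so moving it onto [sM] puts its first symbol on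
    top. *)
Lemma feed_run s R Z V W r :
  reach ks (3 * size W).+1 (lb 19, None, false, s, (R, Z, V, W, cells r))
    (lb 23, None, false, s, (R, Z, V, [::], cells (catrev (map Some W) r))).
Proof.
elim: W r => [|b W IHW] r; first exact: reach1.
rewrite (_ : _.+1 = 3 + (3 * size W).+1); last by rewrite /=; lia.
by apply: reach_trans (IHW (Some b :: r)).
Qed.

Lemma fetch_run_M s R Z V W r : exists2 n, n <= 2 &
  reach ks n (lb 23, None, false, s, (R, Z, V, W, cells r))
    (lb 29, head None r, false, s, (R, Z, V, W, cells (behead r))).
Proof. by case: r => [|[b|] r]; [exists 1 | exists 2 | exists 1]. Qed.

Lemma fetch_run_W s R Z V l X : exists2 n, n <= 2 &
  reach ks n (lb 25, None, false, s, (R, Z, V, cells l, X))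
    (lb 29, head None l, false, s, (R, Z, V, cells (behead l), X)).
Proof. by case: l => [|[b|] l]; [exists 1 | exists 2 | exists 1]. Qed.

Definition machine_cfg (R Z V : seq bool) (cfg : config M) : pstate * stacks :=
  let: (q, l, h, r) := cfg in (lb 29, h, false, q, (R, Z, V, cells l, cells r)).

Lemma machine_step R Z V cfg : ~~ halted cfg -> exists2 n, n <= 4 &
  reach ks n (machine_cfg R Z V cfg) (machine_cfg R Z V (step cfg)).
Proof.
case: cfg => [[[q l] h] r] /=.
case D: (tm_delta q h) => [[[q' w] []]|] //= _.
- have push : exists2 n, n <= 2 &
    reach ks n (lb 29, h, false, q, (R, Z, V, cells l, cells r))
      (lb 25, None, false, q', (R, Z, V, cells l, cells (w :: r))).
    by case: w D => [b|] D; [exists 2 | exists 1] => //; rewrite /reach /= D.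
  have [n len rn] := push; have [k lek rk] := fetch_run_W q' R Z V l (cells (w :: r)).
  exists (n + k); first lia.
  by case: l {D push} rn rk => [|a l] rn rk; exact: reach_trans rn rk.
- have push : exists2 n, n <= 2 &
    reach ks n (lb 29, h, false, q, (R, Z, V, cells l, cells r))
      (lb 23, None, false, q', (R, Z, V, cells (w :: l), cells r)).
    by case: w D => [b|] D; [exists 2 | exists 1] => //; rewrite /reach /= D.
  have [n len rn] := push; have [k lek rk] := fetch_run_M q' R Z V (cells (w :: l)) r.
  exists (n + k); first lia.
  by case: r {D push} rn rk => [|a r] rn rk; exact: reach_trans rn rk.
Qed.

Lemma machine_run R Z V t cfg cfg' : run t cfg = Some cfg' -> exists2 n, n <= 4 * t &
  reach ks n (machine_cfg R Z V cfg) (machine_cfg R Z V cfg').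
Proof.
elim: t cfg => [|t IHt] cfg /=.
  by case: ifP => // _ [<-]; exists 0.
case: ifP => [_ [<-]|/negbT nh /IHt[n len rn]]; first by exists 0.
have [k lek rk] := machine_step R Z V nh.
by exists (k + n); [lia | exact: reach_trans rk rn].
Qed.

Lemma matches_run s Z V W h r :
  decides (lb 30, h, false, s, ([::], Z, V, W, cells r)) (4 * (size V).+1)
    (matches V (read_word (h :: r))).
Proof.
have [N] := ubnP (size V); elim: N V h r => // N IHN [|[] [|b V]] h r /= ltN.
- by apply: (@decides_step_rej 1); first exact: reach1.
- by apply: (@decides_step_rej 2).
- case: h => [b'|]; last by apply: (@decides_step_rej 2); [ | lia].
  case: (eqVneq b b') => [<-|neq] /=; last first.
    apply: (@decides_step_rej 2); last lia.
    by rewrite /reach /= (inj_eq Some_inj) eq_sym (negPf neq).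
  have [n len rn] : exists2 n, n <= 4 &
    reach ks n (lb 30, Some b, false, s, ([::], Z, [:: true, b & V], W, cells r))
      (lb 30, head None r, false, s, ([::], Z, V, W, cells (behead r))).
    by case: r => [|[a|] r]; [exists 3 | exists 4 | exists 3] => //; rewrite /reach /= eqxx.
  (* For empty [r] the fetched cell is a blank, which ends the word as well. *)
  have -> : read_word r = read_word (head None r :: behead r) by case: r {rn}.
  by apply: decides_leq (decides_reach rn (IHN V _ _ _)); lia.
- case: h => [b'|]; first by apply: (@decides_step_rej 1); [exact: reach1 | lia].
  by exists 2, (lb 37, None, false, s), ([:: true], Z, [::], W, cells r).
- case: h => [b'|]; first by apply: (@decides_step_rej 1); [exact: reach1 | lia].
  by exists 2, (lb 37, None, false, s), ([:: true], Z, b :: V, W, cells r).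
Qed.

Lemma skip_run s R Z V W X h :
  match skip V with
  | None => decides (lb 22, h, false, s, (R, Z, V, W, X)) (2 * (size V).+1) false
  | Some V' => size V' < size V /\ exists2 n, n <= 2 * (size V - size V') &
      reach ks n (lb 22, h, false, s, (R, Z, V, W, X)) (lb 28, h, false, s, (R, Z, V', W, X))
  end.
Proof.
have [N] := ubnP (size V); elim: N V => // N IHN [|[] [|b V]] /= ltN.
- by apply: (@decides_step_rej 1); first exact: reach1.
- by apply: (@decides_step_rej 2).
- have r : reach ks 2 (lb 22, h, false, s, (R, Z, [:: true, b & V], W, X))
             (lb 22, h, false, s, (R, Z, V, W, X)) by [].
  have := IHN V; case: skip => [V'|] IH.
    have [|lt [n le_n rn]] := IH; first lia.
    by split; [lia | exists (2 + n); [lia | exact: reach_trans r rn]].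
  by apply: decides_leq (decides_reach r (IH _)); lia.
- by split=> //; exists 1 => //; exact: reach1.
- by split=> //; exists 1; [lia | exact: reach1].
Qed.

Lemma lookup_run s Z V W h r :
  decides (lb 28, h, false, s, ([::], Z, V, W, cells r)) (4 * (size V).+1 + size Z + 1)
    (lookup Z V (read_word (h :: r))).
Proof.
elim: Z V => [|[] Z IHZ] V /=.
- by apply: (@decides_step_rej 1); [exact: reach1 | lia].
- apply: (decides_leq (m := 1 + 4 * (size V).+1)); first lia.
  apply: decides_reach (matches_run s Z V W h r); exact: reach1.
have r1 : reach ks 1 (lb 28, h, false, s, ([::], false :: Z, V, W, cells r))
            (lb 22, h, false, s, ([::], Z, V, W, cells r)) by exact: reach1.
have := skip_run s [::] Z V W (cells r) h; case: skip => [V'|].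
  move=> [ltV [n len rn]].
  by apply: decides_leq (decides_reach (reach_trans r1 rn) (IHZ V')); lia.
by move=> H; apply: decides_leq (decides_reach r1 H); lia.
Qed.

Hypothesis M_computes : forall x,
  exists cfg, run (c * (size x).+1 ^ d) (init M x) = Some cfg /\ output cfg = f x.

(** When the simulated machine halts, label 29 carries the same instruction as label 28, so the list
    search may start there without an extra step. *)
Lemma decides_code q1 q2 S n b :
  code q1 = code q2 -> code q2 <> Halt -> decides (q2, S) n b -> decides (q1, S) n b.
Proof.
move=> eq12 nh [[|k] [q [s [lek rk hq vb]]]].
  by case: rk hq => <- _ /nh.
have step12 : ks (q1, S) = ks (q2, S) by rewrite /kstep eq12; case: (code q2) nh.
by exists k.+1, q, s; split=> //; rewrite /reach iterSr step12 -iterSr.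
Qed.

Lemma final_run m Z V R W :
  decides (lb 18, None, m, ord0, (R, Z, V, W, [::]))
    (4 * (c * (size W).+1 ^ d) + 4 * (size V).+1 + size Z + 3 * size W + 5)
    ((R == [::]) && lookup Z V (f (rev W))).
Proof.
case: R => [|b R]; last by apply: (@decides_step_rej 1); [exact: reach1 | lia].
rewrite eqxx /=.
have r1 : reach ks 1 (lb 18, None, m, ord0, ([::], Z, V, W, [::]))
            (lb 19, None, false, ord0, ([::], Z, V, W, cells [::])) by exact: reach1.
have r2 := reach_trans r1 (feed_run ord0 [::] Z V W [::]).
have [n3 len3 r3] := fetch_run_M ord0 [::] Z V [::] (catrev (map Some W) [::]).
have r4 := reach_trans r2 r3.
have [cfg []] := M_computes (rev W).
rewrite size_rev => run_cfg <-; have [n5 len5 r5] := machine_run [::] Z V run_cfg.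
have start : machine_cfg [::] Z V (init M (rev W)) =
  (lb 29, head None (catrev [seq Some i | i <- W] [::]), false, ord0,
           ([::], Z, V, [::], cells (behead (catrev [seq Some i | i <- W] [::])))).
  rewrite catrevE cats0 -map_rev; by case: (rev W).
rewrite start in r5; have r6 := reach_trans r4 r5.
have [hcfg _] := iter_run run_cfg.
case: cfg run_cfg r5 r6 hcfg => [[[q l] h] r] _ r5 r6 /= hq.
set N1 := _ + n5 in r6.
apply: (decides_leq (m := N1 + (4 * (size V).+1 + size Z + 1))); first by rewrite /N1; lia.
apply: (decides_reach r6); apply: decides_code (lookup_run q Z V (cells l) h r) => //.
by rewrite /=; case: (tm_delta q h) hq.
Qed.

Lemma catrev_nil (T : Type) (x : seq T) : catrev x [::] = rev x.
Proof. by []. Qed.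

Lemma unpair_size z acc x y :
  unpair z acc = Some (x, y) -> (size x <= size z + size acc) /\ (size y <= size z).
Proof.
have [N] := ubnP (size z); elim: N z acc => // N IHN [|a [|b z]] acc //= ltN.
case: ifP => _; last by case: b ltN => // ltN [<- <-]; split; lia.
by move=> /IHN[|/=]; lia.
Qed.

Lemma gen_size v m x y w v' x' y' w' : gen v m x y w = Some (v', x', y', w') ->
  [/\ size v' <= size v, size y' <= size y & size w' <= size v + size w].
Proof.
have [N] := ubnP (size v); elim: N v m x y w => // N IHN [|[] [|[] v]] m x y w //=.
- case: v => [|[] v] //= ltN; first by case=> <- _ <- <-; split; lia.
  case: m; [case: x => // b x | case: y => // b y]; (move=> /IHN[|/= ? ? ?]; [lia | split; lia]).
- by move=> ltN; case: y => // m' y /IHN[|/= ? ? ?]; [lia | split; lia].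
- by move=> ltN /IHN[|/= ? ? ?]; [lia | split; lia].
- by move=> ltN /IHN[|/= ? ? ?]; [lia | split; lia].
Qed.

Definition vtime (N : nat) := 4 * (c * N.+1 ^ d) + 60 * N.+1.

Lemma program_run z :
  decides (lb 0, None, false, ord0, kinit z) (vtime (size z)) (verify f z).
Proof.
rewrite /kinit /verify /vtime; set N := size z.
have r1 := load_run ord0 (rev z) [::] [::] [::] [::].
rewrite catrev_nil revK size_rev -/N in r1.
have H2 := unpair_run_Z ord0 z [::] [::] [::] [::].
case E2: unpair H2 => [[u y]|]; last first.
  by move=> H2; apply: decides_leq (decides_reach r1 H2); rewrite -/N; lia.
move=> [n2 len2 r2]; have r3 := reach_trans r1 r2.
have [leu ley] := unpair_size E2; rewrite /= addn0 -/N in leu ley len2.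
have r4 := reach_trans r3 (swap_run ord0 u y [::] [::] [::]).
rewrite catrev_nil in r4.
have := unpair_run_V ord0 y [::] (rev u) [::] [::].
case E5: unpair => [[x v]|]; rewrite size_rev; last first.
  by move=> H5; apply: decides_leq (decides_reach r4 H5); lia.
move=> [n5 len5 r5]; have r6 := reach_trans r4 r5.
have [_ lev] := unpair_size E5; rewrite size_rev in lev.
have := gen_run ord0 false x y v [::] [::].
case E7: gen => [[[[v' x'] y'] w]|]; last first.
  by move=> H7; apply: decides_leq (decides_reach r6 H7); lia.
move=> [n7 len7 [m r7]]; have r8 := reach_trans r6 r7.
have [lev' ley' lew] := gen_size E7; rewrite /= addn0 in lew.
apply: decides_leq (decides_reach r8 (final_run m y' v' x' w)).
have : (size w).+1 ^ d <= N.+1 ^ d by case: (d) => // k; rewrite leq_exp2r; lia.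
by set X := _ ^ d; set Y := _ ^ d; nia.
Qed.

Theorem verify_poly_time : poly_time_decidable (fun z => verify f z).
Proof.
(* Computability is stated for a function, whereas [program_run] only yields some final stack for
   each input; the function is obtained by choice. *)
have [R RP] : exists R : seq bool -> seq bool, forall z, exists k q s,
    [/\ k <= vtime (size z), reach ks k (lb 0, None, false, ord0, kinit z) (q, s),
        code q = Halt, verdict (verify f z) (get sR s) & get sR s = R z].
  apply: (fun_choice (P := fun z R => exists k q s, [/\ k <= vtime (size z), _,
        code q = Halt, verdict (verify f z) (get sR s) & get sR s = R])) => z.
  have [k [q [s [? ? ? ?]]]] := program_run z.
  by exists (get sR s), k, q, s; split.
exists (fun z => rev (R z)); split; last first.
  move=> z; have [k [q [s [_ _ _ vd <-]]]] := RP z.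
  case: (verify f z) vd => [-> // | [R' ->]]; split=> //.
  by move/(congr1 rev); rewrite revK.
apply: (stack_machine_poly_time (code := code) (q0 := (lb 0, None, false, ord0))
          (c := 4 * c + 60) (d := d.+1)).
move=> z; have [k [q [s [lek rk hq _ sR]]]] := RP z.
exists k, q, s; split=> //; last by rewrite revK.
apply: (leq_trans lek); rewrite /vtime expnS.
have : 0 < (size z).+1 ^ d by rewrite expn_gt0.
by set X := _ ^ d; nia.
Qed.

End Program.

(** * Injectivity of the encodings and the covering argument *)

Definition dbl (x : seq bool) : seq bool := flatten (map (fun b => [:: b; b]) x).

Lemma pair_enc_inj x y x' y' : pair_enc x y = pair_enc x' y' -> x = x' /\ y = y'.
Proof.
rewrite /pair_enc; elim: x x' => [|a x IHx] [|a' x'] //=.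
- by case=> <-.
- by case=> <-.
- by case=> ->.
by case=> <- _ /IHx[-> ->].
Qed.

Lemma enc_pk_inj x k x' k' : enc_pk x k = enc_pk x' k' -> x = x' /\ k = k'.
Proof. by move=> /pair_enc_inj[-> /(congr1 size)]; rewrite !size_nseq. Qed.

Lemma size_dbl x : size (dbl x) = 2 * size x.
Proof. by elim: x => //= b x; rewrite /dbl => ->; lia. Qed.

Lemma size_pair_enc x y : size (pair_enc x y) = 2 * size x + 2 + size y.
Proof. by rewrite /pair_enc !size_cat -/(dbl x) size_dbl /=; lia. Qed.

Definition bits_value (s : seq bool) : nat := foldl (fun (n : nat) (b : bool) => n.*2 + b) 0 s.

Lemma bits_fuelK fuel n : n <= fuel -> bits_value (bits_fuel fuel n) = n.
Proof.
elim: fuel n => [|fuel IHf] [|n] //= le_nf.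
rewrite /bits_value foldl_rcons -/(bits_value _) IHf; last by rewrite leq_uphalf_double; lia.
by rewrite addnC -[RHS]odd_double_half.
Qed.

Lemma bits_inj : injective bits.
Proof. by move=> m n /(congr1 bits_value); rewrite !bits_fuelK. Qed.

Lemma size_bits_fuel fuel n : size (bits_fuel fuel n) <= n.
Proof.
elim: fuel n => [|fuel IHf] [|n] //=; rewrite size_rcons ltnS.
by apply: leq_trans (IHf _) _; rewrite leq_uphalf_double; lia.
Qed.

(** All tokens have three bits and [tok_endnum] is not a digit, so the end of a number is recognised
    whatever text follows. The next lemmas lift this to literals, clauses and formulas. *)
Lemma digits_inj ds es s s' :
  flatten (map tok_digit ds) ++ tok_endnum ++ s = flatten (map tok_digit es) ++ tok_endnum ++ s' ->
  ds = es /\ s = s'.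
Proof.
elim: ds es => [|[] ds IH] [|[] es] //=.
- by case.
- by case=> /IH[-> ->].
- by case=> /IH[-> ->].
Qed.

Lemma enc_nat_inj m n s s' : enc_nat m ++ s = enc_nat n ++ s' -> m = n /\ s = s'.
Proof. by rewrite /enc_nat -!catA => /digits_inj[/bits_inj -> ->]. Qed.

Lemma enc_lit_inj l l' s s' : enc_lit l ++ s = enc_lit l' ++ s' -> l = l' /\ s = s'.
Proof.
case: l => [v b]; case: l' => [v' b']; rewrite /enc_lit -!(catA (tok_digit _)) /fst /snd.
move: (@enc_nat_inj v v' s s'); move: (_ ++ s) (_ ++ s') => t t' tt'.
by case: b; case: b' => //= -[] /tt'[-> ->].
Qed.

Lemma enc_clause_inj C C' s s' : enc_clause C ++ s = enc_clause C' ++ s' -> C = C' /\ s = s'.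
Proof.
rewrite /enc_clause -!(catA (flatten _)); elim: C C' => [|l C IH] [|l' C'] //=.
- by case.
- by case: l' => [v []].
- by case: l => [v []].
by rewrite -!(catA (enc_lit _)) => /enc_lit_inj[-> /IH[-> ->]].
Qed.

(** [SAT3_backdoor] speaks of some formula behind a text; this lemma makes it the intended one. *)
Lemma enc_cnf_inj F F' s s' : enc_cnf F ++ s = enc_cnf F' ++ s' -> F = F' /\ s = s'.
Proof.
(* A clause code begins with [false] and [tok_endformula] with [true]. *)
have start C t : exists a b u, enc_clause C ++ t = [:: false, a, b & u].
  by case: C => [|[v []] C]; do 3 eexists.
rewrite /enc_cnf -!(catA (flatten _)); elim: F F' => [|C F IH] [|C' F'] //=.
- by case.
- by rewrite -!(catA (enc_clause _)); have [a [b [u ->]]] := start C' (flatten (map enc_clause F') ++ tok_endformula ++ s').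
- by rewrite -!(catA (enc_clause _)); have [a [b [u ->]]] := start C (flatten (map enc_clause F) ++ tok_endformula ++ s).
by rewrite -!(catA (enc_clause _)) => /enc_clause_inj[-> /IH[-> ->]].
Qed.

(** * Covering a set by tuples with few different outputs *)

Section Covering.

Variables (X O : finType) (t : nat) (g : {ffun 'I_t -> X} -> O).

Definition covered (S : {set X}) (o : O) : {set X} :=
  [set x in S | [exists h : {ffun 'I_t -> X},
     [&& h \in ffun_on (mem S), g h == o & [exists i, h i == x]]]].

(* Counting: the tuples over [S] with image [o] all lie in [covered S o] ^ t, so some [o] covers half of [S]. *)
Lemma some_output_covers_half (S : {set X}) : #|O| <= 2 ^ t -> 0 < t -> S != set0 ->
  exists o, #|S| <= 2 * #|covered S o|.
Proof.
move=> leO t_gt0 nzS; apply/existsP; case: (boolP [exists o, _]) => // /existsPn small.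
have S_gt0 : 0 < #|S| by rewrite card_gt0.
have: #|S| ^ t <= \sum_o #|covered S o| ^ t.
  have := card_ffun_on 'I_t (mem S); rewrite card_ord => <-.
  rewrite -sum1_card (partition_big g xpredT) //=; apply: leq_sum => o _.
  have := card_ffun_on 'I_t (mem (covered S o)); rewrite card_ord => <-.
  rewrite sum1_card; apply: subset_leq_card; apply/subsetP => h.
  rewrite unfold_in => /andP[hS /eqP gh]; apply/ffun_onP => i.
  rewrite /= inE; apply/andP; split; first exact: (ffun_onP hS).
  by apply/existsP; exists h; rewrite hS gh eqxx; apply/existsP; exists i.
rewrite -(leq_pmul2l (_ : 0 < 2 ^ t)) ?expn_gt0 // leqNgt => /negP[].
rewrite big_distrr /=.
(* Twice a covered set has at most [#|S|.-1] elements. This loss of one gives the strict inequality,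
   as t is positive and there are at most 2 ^ t outputs. *)
apply: (@leq_ltn_trans (\sum_(o : O) #|S|.-1 ^ t)).
  apply: leq_sum => o _; rewrite -expnMn leq_exp2r //.
  by have := small o; rewrite -ltnNge; lia.
rewrite sum_nat_const; apply: (@leq_ltn_trans (2 ^ t * #|S|.-1 ^ t)).
  by rewrite leq_mul2r leO orbT.
by rewrite ltn_pmul2l ?expn_gt0 // ltn_exp2r // prednK.
Qed.

(** Each chosen output at least halves what is left of [S], so n rounds exhaust it. The last clause
    serves soundness: a listed output always comes from a tuple inside [S]. *)
Lemma few_outputs_cover n (S : {set X}) : #|O| <= 2 ^ t -> 0 < t -> #|S| < 2 ^ n ->
  exists A : seq O, [/\ size A <= n,
    forall x, x \in S -> exists h : {ffun 'I_t -> X},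
      [/\ forall i, h i \in S, g h \in A & exists i, h i = x]
  & forall o, o \in A -> exists h : {ffun 'I_t -> X}, (forall i, h i \in S) /\ g h = o].
Proof.
move=> leO t_gt0; elim: n S => [|n IHn] S ltS.
  exists [::]; split=> // x xS.
  by move: ltS; rewrite (cardD1 x) xS.
case: (eqVneq S set0) => [->|nzS]; first by exists [::]; split=> // x; rewrite inE.
have [o leSo] := some_output_covers_half leO t_gt0 nzS.
have subS : covered S o \subset S by apply/subsetP => x; rewrite inE => /andP[].
have [|A [sA Acov Aim]] := IHn (S :\: covered S o).
  have := cardsID (covered S o) S; rewrite (setIidPr subS); rewrite expnS in ltS.
  by move: #|_| #|_| leSo ltS => a b ? ? ?; lia.
have DS h : (forall i : 'I_t, h i \in S :\: covered S o) -> forall i, h i \in S.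
  by move=> hD i; have := hD i; rewrite inE => /andP[].
exists (o :: A); split=> // [x xS | o'].
  case: (boolP (x \in covered S o)) => [|xNo].
    rewrite inE => /andP[_ /existsP[h /and3P[/ffun_onP hS /eqP gh /existsP[i /eqP hi]]]].
    by exists h; split=> //; [rewrite gh mem_head | exists i].
  have [|h [hS gA hx]] := Acov x; first by rewrite inE xNo.
  by exists h; split=> //; [exact: DS | rewrite inE gA orbT].
rewrite inE => /predU1P[->|/Aim[h [hS gh]]]; last by exists h; split=> //; exact: DS.
have: 0 < #|covered S o| by move: nzS; rewrite -card_gt0; lia.
rewrite card_gt0 => /set0Pn[x]; rewrite inE => /andP[_ /existsP[h /and3P[/ffun_onP hS /eqP gh _]]].
by exists h.
Qed.

End Covering.

(** * Three-literal clauses describing the runs of a verifier *)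

Definition sat_clause (V : Type) (alpha : V -> bool) (C : seq (V * bool)) : bool :=
  has (fun l => alpha l.1 == l.2) C.

Lemma nth_dbl u i : nth false (dbl u) i = nth false u i./2.
Proof. by elim: u i => [|b u IHu] [|[|i]] //=. Qed.

Lemma word_tape_pair u y i : word_tape (pair_enc u y) (Z.of_nat i) =
  if i < 2 * size u then Some (nth false u i./2)
  else if i == 2 * size u then Some false
  else if i == (2 * size u).+1 then Some true
  else nth None (map Some y) (i - 2 * size u - 2).
Proof.
rewrite word_tape_nat /pair_enc -/(dbl u) map_cat nth_cat size_map size_dbl.
case: ltnP => [lt|ge]; first by rewrite (nth_map false) ?size_dbl // nth_dbl.
move: (i - 2 * size u) (subnKC ge) => k <-.
case: eqP => [ek|n0]; first by have -> : k = 0 by lia.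
case: eqP => [ek|n1]; first by have -> : k = 1 by lia.
case: k n0 n1 => [|[|k]] n0 n1; [exfalso; lia | exfalso; lia |].
by rewrite /= !subSS subn0.
Qed.

Section Tableau.

Variables (M : tm) (f : seq bool -> seq bool) (c d : nat).
Hypothesis M_computes : forall x,
  exists cfg, run (c * (size x).+1 ^ d) (init M x) = Some cfg /\ output cfg = f x.

Variables (n q T : nat).
Hypothesis T_input : 2 * n + 2 + q <= T.
Hypothesis T_time : c * (2 * n + 2 + q).+1 ^ d <= T.

Definition hist (u y : seq bool) (i : nat) : acfg 'I_(tm_n M).+1 :=
  iter i (astep (@tm_delta M)) (ord0, word_tape (pair_enc u y), 0%Z).

Definition accepting (u y : seq bool) : Prop :=
  [/\ size u = n, size y <= q & f (pair_enc u y) = [:: true]].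

(* Tape positions [-T .. T+1] are shifted by [T]; [inl s] says that the head is at this position
   in state [s], [inr a] that the cell contains [a]. *)
Definition tvar := ('I_T.+1 * 'I_(T.*2.+2) * ('I_(tm_n M).+1 + option bool))%type.

Definition var (i : nat) (z : Z) k : tvar := (inord i, inord (Z.to_nat (z + Z.of_nat T)), k).

Definition hist_val (u y : seq bool) (v : tvar) : bool :=
  let: (i, r, k) := v in
  let: (s, Tp, p) := hist u y i in
  let z := (Z.of_nat r - Z.of_nat T)%Z in
  match k with
  | inl s' => (s' == s) && Z.eqb p z
  | inr a => a == Tp z
  end.

Arguments var : simpl never.
Arguments hist_val : simpl never.

(** The head stays within distance T of the origin; position T + 1 is there because acceptance
    inspects the cell to the right of the head. *)
Definition in_window (z : Z) : Prop := (- Z.of_nat T <= z <= Z.of_nat T + 1)%Z.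

Lemma hist_val_var u y i z k : i <= T -> in_window z ->
  hist_val u y (var i z k) =
  let: (s, Tp, p) := hist u y i in
  match k with inl s' => (s' == s) && Z.eqb p z | inr a => a == Tp z end.
Proof.
move=> leiT win; rewrite /hist_val /var !inordK //; last by rewrite /in_window in win; lia.
have -> // : (Z.of_nat (Z.to_nat (z + Z.of_nat T)) - Z.of_nat T = z)%Z.
by rewrite /in_window in win; lia.
Qed.

(** Pairing doubles the first word, so its bit j fills cells 2j and 2j + 1; the even cell represents
    it. *)
Definition input_var (j : nat) : tvar := var 0 (Z.of_nat j.*2) (inr (Some true)).

Lemma hist_val_input u y j : size u = n -> j < n -> hist_val u y (input_var j) = nth false u j.
Proof.
move=> szu ltjn; rewrite hist_val_var //; last by rewrite /in_window; lia.
rewrite /hist /= word_tape_pair doubleK szu (_ : _ < _ = true) //; lia.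
Qed.

(* The formula consists of all valid clauses of size at most 3, so that listing clauses is
   replaced by checking, when one is needed, that it is valid. *)
Definition valid (C : seq (tvar * bool)) : Prop :=
  forall u y, accepting u y -> sat_clause (hist_val u y) C.

(** By [T_time] the run has halted by time T and is constant afterwards, also for certificates
    shorter than q. The output is [[:: true]] when a scanned 1 is followed by a blank. *)
Lemma accepting_output u y : size u = n -> size y <= q ->
  f (pair_enc u y) = [:: true] <->
  let: (s, Tp, p) := hist u y T in Tp p = Some true /\ Tp (p + 1)%Z = None.
Proof.
move=> szu szy; have [cfg [run_cfg <-]] := M_computes (pair_enc u y).
have [_ itT] := iter_run run_cfg.
have deltaE : forall s h, @tm_delta M (id s) h =
  omap (fun r => (id r.1.1, r.1.2, r.2)) (tm_delta s h).
  by move=> s h; case: (tm_delta s h) => [[[]]|].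
have := rep_iter deltaE T (rep_init id (pair_enc u y)).
rewrite itT; last first.
  apply: leq_trans T_time; rewrite size_pair_enc szu leq_mul2l; apply/orP; right.
  by case: (d) => // k; rewrite leq_exp2r //; lia.
rewrite -/(hist u y T); case: (hist u y T) => [[s Tp] p].
case: cfg {run_cfg itT} => [[[s' l] h] r] [_ Th Tr _] /=.
have -> : Tp (p + 1)%Z = head None r by rewrite -nth0 Tr; congr Tp; lia.
rewrite Th; case: h {Th} => [[]|] /=.
- by case: r {Tr} => [|[b|] r] /=; [split | split=> -[] | split].
- by split=> // -[].
- by split=> // -[].
Qed.

(* Each cell of the next configuration depends on the state, the head position and one old cell,
   which is why clauses of size 3 suffice. *)
Lemma astep_local (S : Type) (delta : table S) (a b : acfg S) z :
  a.1.1 = b.1.1 -> a.2 = b.2 -> a.1.2 z = b.1.2 z ->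
  (astep delta a).1.2 z = (astep delta b).1.2 z.
Proof.
case: a => [[s Ta] p]; case: b => [[s' Tb] p'] /= <- <- ez.
case: (Z.eq_dec z p) => [ezp|nzp].
  by rewrite -ezp -ez; case: (delta s (Ta z)) => [[[s'' w] dr]|] //=; rewrite !upd_same.
case: (delta s (Ta p)) => [[[s1 w1] d1]|]; case: (delta s (Tb p)) => [[[s2 w2] d2]|] //=;
  by rewrite ?upd_diff.
Qed.

Lemma astep_head_local (S : Type) (delta : table S) (a b : acfg S) :
  a.1.1 = b.1.1 -> a.2 = b.2 -> a.1.2 a.2 = b.1.2 a.2 ->
  (astep delta a).1.1 = (astep delta b).1.1 /\ (astep delta a).2 = (astep delta b).2.
Proof.
case: a => [[s Ta] p]; case: b => [[s' Tb] p'] /= <- <- ->.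
by case: (delta s (Tb p)) => [[[]]|].
Qed.

Lemma hist_head u y i : (- Z.of_nat i <= (hist u y i).2 <= Z.of_nat i)%Z.
Proof.
elim: i => [|i]; first by rewrite /=; lia.
rewrite /hist iterS -/(hist u y i); case: (hist u y i) => [[s Tp] p] /=.
by case: (tm_delta s (Tp p)) => [[[s' w] []]|] /=; lia.
Qed.

(** * From an assignment satisfying all valid clauses to an accepting run *)

Section Soundness.

Variable alpha : tvar -> bool.
Hypothesis alpha_valid : forall C, size C <= 3 -> valid C -> sat_clause alpha C.

Let u := mkseq (fun j => alpha (input_var j)) n.

Let blank j := alpha (var 0 (Z.of_nat (2 * n + 2 + j)) (inr None)).

(** The certificate is cut at its first blank cell, or at length q if there is none. *)
Let len := find blank (iota 0 q).

Let y := mkseq (fun j => alpha (var 0 (Z.of_nat (2 * n + 2 + j)) (inr (Some true)))) len.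

Let size_u : size u = n. Proof. exact: size_mkseq. Qed.

Let size_y : size y <= q.
Proof. by rewrite size_mkseq (leq_trans (find_size _ _)) // size_iota. Qed.

Lemma decoded_cell z : in_window z -> alpha (var 0 z (inr (word_tape (pair_enc u y) z))).
Proof.
move=> win.
have cellE u' y' z' a : in_window z' ->
    hist_val u' y' (var 0 z' (inr a)) = (a == word_tape (pair_enc u' y') z').
  by move=> win'; rewrite hist_val_var.
(* A cell with the same content in all accepting runs is fixed by a clause of one literal. *)
have unit_clause a : (forall u' y', accepting u' y' -> word_tape (pair_enc u' y') z = a) ->
    alpha (var 0 z (inr a)).
  move=> H; have := alpha_valid (C := [:: (var 0 z (inr a), true)]) isT.
  rewrite /sat_clause /= orbF eqb_id; apply=> u' y' /H Hz.
  by rewrite /sat_clause /= cellE // Hz eqxx.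
case: (Z.ltb_spec z 0) => [zneg|zpos].
  by rewrite word_tape_neg //; apply: unit_clause => u' y' _; rewrite word_tape_neg.
move: win unit_clause; rewrite -(Z2Nat.id z) //; move: (Z.to_nat z) => {z zpos} i win unit_clause.
rewrite word_tape_pair size_u.
case: (ltnP i) => [lti|gei].
  have ltj : i./2 < n by rewrite ltn_half_double; lia.
  have inputE u' y' : accepting u' y' -> hist_val u' y' (input_var i./2) = nth false u' i./2.
    by case=> szu' _ _; exact: hist_val_input.
  have tapeE u' y' : accepting u' y' ->
      word_tape (pair_enc u' y') (Z.of_nat i) = Some (nth false u' i./2).
    by case=> szu' _ _; rewrite word_tape_pair szu' lti.
  rewrite nth_mkseq //; set b := alpha (input_var _).
  (* If the input bit is [b], then cell i contains [b]: this carries the value of the even cell to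
     its twin. *)
  have := alpha_valid (C := [:: (input_var i./2, ~~ b); (var 0 (Z.of_nat i) (inr (Some b)), true)]) isT.
  rewrite /sat_clause /= -/b orbF eqb_id; case: eqP => [|_ /=]; first by case: (b).
  apply=> u' y' acc; rewrite /sat_clause /= inputE // cellE // tapeE //.
  by case: (b); case: (nth _ _ _).
case: eqP => [ei|ne0].
  apply: unit_clause => u' y' [szu' _ _]; rewrite word_tape_pair szu' ltnNge gei /=.
  by case: eqP.
case: eqP => [ei|ne1].
  apply: unit_clause => u' y' [szu' _ _]; rewrite word_tape_pair szu' ltnNge gei /=.
  by case: eqP => // _; case: eqP.
have tapeE u' y' : accepting u' y' ->
    forall j, word_tape (pair_enc u' y') (Z.of_nat (2 * n + 2 + j)) = nth None (map Some y') j.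
  case=> szu' _ _ j; rewrite word_tape_pair szu'.
  case: ltnP => [|_]; first lia.
  case: eqP => [|_]; first lia.
  by case: eqP => [|_]; [lia | congr nth; lia].
have [j ij] : exists j, i = 2 * n + 2 + j by exists (i - 2 * n - 2); lia.
rewrite ij in win unit_clause *; have -> : 2 * n + 2 + j - 2 * n - 2 = j by lia.
case: (ltnP j len) => [ltj|gej].
  rewrite (nth_map false) ?size_mkseq // nth_mkseq //.
  have notblank : blank j = false.
    have := before_find 0 ltj; rewrite nth_iota // (leq_trans ltj) //.
    by rewrite (leq_trans (find_size _ _)) // size_iota.
  case E: (alpha (var 0 (Z.of_nat (2 * n + 2 + j)) (inr (Some true)))) => [|]; first exact: E.
  (* Three literals are just enough to say that a cell is blank, 1 or 0. *)
  have := alpha_valid (C := [:: (var 0 (Z.of_nat (2 * n + 2 + j)) (inr None), true);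
    (var 0 (Z.of_nat (2 * n + 2 + j)) (inr (Some true)), true);
    (var 0 (Z.of_nat (2 * n + 2 + j)) (inr (Some false)), true)]) isT.
  rewrite /sat_clause /= -/(blank j) notblank E orbF !eqb_id /= => H.
  by apply: H => u' y' acc; rewrite /sat_clause /= !cellE // tapeE //; case: nth => [[]|].
rewrite nth_default; last by rewrite size_map size_mkseq.
case: (ltnP len q) => [ltq|geq].
  have blank_len : blank len.
    have : has blank (iota 0 q) by rewrite has_find size_iota.
    by move/(nth_find 0); rewrite nth_iota.
  (* A word has no gaps, so a blank at [len] forces blanks further on. *)
  have := alpha_valid (C := [:: (var 0 (Z.of_nat (2 * n + 2 + len)) (inr None), false);
    (var 0 (Z.of_nat (2 * n + 2 + j)) (inr None), true)]) isT.
  rewrite /sat_clause /= -/(blank len) blank_len /= orbF eqb_id; apply=> u' y' acc.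
  rewrite /sat_clause /= !cellE //; last by rewrite /in_window; lia.
  rewrite !tapeE //; case: (ltnP len (size y')) => [lt|ge]; first by rewrite (nth_map false).
  have -> : nth None (map Some y') j = None by rewrite nth_default // size_map; lia.
  by rewrite /= orbT.
apply: unit_clause => u' y' acc; rewrite tapeE // nth_default // size_map.
by case: acc => _; lia.
Qed.

(** Only the atoms that hold in the decoded run are shown true under [alpha]; nothing is claimed
    about the others. This suffices, since each clause used here derives such an atom from earlier
    ones. *)
Lemma decoded_hist i : i <= T ->
  let: (s, Tp, p) := hist u y i in
  alpha (var i p (inl s)) /\ forall z, in_window z -> alpha (var i z (inr (Tp z))).
Proof.
elim: i => [|i IHi] leiT.
  split; last exact: decoded_cell.
  have := alpha_valid (C := [:: (var 0 0 (inl ord0), true)]) isT.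
  rewrite /sat_clause /= orbF eqb_id; apply=> u' y' _.
  by rewrite /sat_clause /= hist_val_var // /in_window; lia.
have hS w x : hist w x i.+1 = astep (@tm_delta M) (hist w x i) by [].
have := hist_head u y i; have := hist_head u y i.+1; move: (IHi (ltnW leiT)).
rewrite hS; case Ei: (hist u y i) => [[s Tp] p] [Hs Hc] /=.
set a' := match _ with None => _ | _ => _ end.
have a'E : a' = astep (@tm_delta M) (s, Tp, p) by [].
case Ea': a' => [[s' Tp'] p'] /= hp' hp.
have winp : in_window p by rewrite /in_window; lia.
have winp' : in_window p' by rewrite /in_window; lia.
(* Any other run either falsifies a premise of the clause or agrees with the decoded run in
   everything that the locality of [astep] refers to. *)
have same u' y' z : in_window z ->
   (hist_val u' y' (var i p (inl s)) == false) || (hist_val u' y' (var i z (inr (Tp z))) == false)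
   \/ [/\ (hist u' y' i).1.1 = s, (hist u' y' i).2 = p & (hist u' y' i).1.2 z = Tp z].
  move=> win; rewrite !hist_val_var //; try exact: ltnW.
  case: (hist u' y' i) => [[s1 T1] p1] /=.
  case: (s =P s1) => [<-|_] /=; last by left.
  case: Z.eqb_spec => [->|_] /=; last by left.
  by case: (Tp z =P T1 z) => [->|_] /=; [right | left].
split.
  have := alpha_valid (C := [:: (var i p (inl s), false); (var i p (inr (Tp p)), false);
                               (var i.+1 p' (inl s'), true)]) isT.
  rewrite /sat_clause /= Hs Hc // orbF eqb_id; apply=> u' y' acc.
  rewrite /sat_clause /= orbA orbF eqb_id; apply/orP.
  have [->|[e1 e2 e3]] := same u' y' p winp; [by left | right].
  rewrite hist_val_var // hS.
  have [] := @astep_head_local _ (@tm_delta M) (hist u' y' i) (s, Tp, p) e1 e2 _.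
    by rewrite e2 e3.
  rewrite -a'E Ea' /=; case: (astep _ _) => [[s2 T2] p2] /= -> ->.
  by rewrite eqxx Z.eqb_refl.
move=> z win.
have := alpha_valid (C := [:: (var i p (inl s), false); (var i z (inr (Tp z)), false);
                             (var i.+1 z (inr (Tp' z)), true)]) isT.
rewrite /sat_clause /= Hs Hc // orbF eqb_id; apply=> u' y' acc.
rewrite /sat_clause /= orbA orbF eqb_id; apply/orP.
have [->|[e1 e2 e3]] := same u' y' z win; [by left | right].
rewrite hist_val_var // hS.
have := @astep_local _ (@tm_delta M) (hist u' y' i) (s, Tp, p) z e1 e2 e3.
by rewrite -a'E Ea' /=; case: (astep _ _) => [[s2 T2] p2] /= ->.
Qed.

Theorem tableau_sound : exists u y, accepting u y /\ forall j, j < n -> nth false u j = alpha (input_var j).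
Proof.
exists u, y; split; last by move=> j ltj; rewrite nth_mkseq.
split=> //; apply/(accepting_output size_u size_y).
have := decoded_hist (leqnn T); have := hist_head u y T.
case Ei: (hist u y T) => [[s Tp] p] /= hp [Hs Hc].
have winp : in_window p by rewrite /in_window; lia.
have winp1 : in_window (p + 1) by rewrite /in_window; lia.
apply: NNPP => rejects.
(* If the decoded run rejects, this clause is valid: an accepting run violating it would show the
   same two cells under its head. *)
have := alpha_valid (C := [:: (var T p (inl s), false); (var T p (inr (Tp p)), false);
                             (var T (p + 1) (inr (Tp (p + 1)%Z)), false)]) isT.
rewrite /sat_clause /= Hs !Hc //= => H; suff: false by [].
apply: H => u' y' [szu' szy' /(accepting_output szu' szy')].
rewrite /sat_clause /= !hist_val_var //.
case: (hist u' y' T) => [[s1 T1] p1] /= [h1 h2].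
case: (s =P s1) => [_|//] /=; case: Z.eqb_spec => [ep|//] /=.
case: (Tp p =P T1 p) => [e1|//] /=; case: (Tp (p + 1)%Z =P T1 (p + 1)%Z) => [e2|//] /=.
by case: rejects; rewrite e1 e2 -ep.
Qed.

End Soundness.

End Tableau.

Arguments var : simpl never.
Arguments hist_val : simpl never.

(** * The disjunction of 2 ^ e membership questions *)

Definition asbool (P : Prop) : bool := if excluded_middle_informative P then true else false.

Lemma asboolP (P : Prop) : reflect P (asbool P).
Proof. by rewrite /asbool; case: excluded_middle_informative => H; constructor. Qed.

Definition light (C : clause) : bool := (size C <= 2) && (count (fun l : lit => l.2) C <= 1).

Lemma light_Horn F : all light F -> isHorn F.
Proof.
apply: sub_all => C /andP[_]; apply: leq_trans.
by rewrite leq_count_subseq // undup_subseq.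
Qed.

Lemma light_2CNF F : all light F -> is2CNF F.
Proof. by apply: sub_all => C /andP[+ _]; apply: leq_trans; exact: size_undup. Qed.

Section Instance.

Variables (M : tm) (f : seq bool -> seq bool) (c d : nat).
Hypothesis M_computes : forall x,
  exists cfg, run (c * (size x).+1 ^ d) (init M x) = Some cfg /\ output cfg = f x.

Variables (n q T : nat).
Hypothesis T_input : 2 * n + 2 + q <= T.
Hypothesis T_time : c * (2 * n + 2 + q).+1 ^ d <= T.

Variable e : nat.

(* Backdoor variables: the tableau and the bits of the selected index.  The remaining
   variables form a binary tree; node [(k, x)] is true when [x] is the prefix of length [k]
   of the selected index, so the leaf [(e, i)] selects the [i]-th word. *)
Definition bvar := (tvar M T + 'I_e.+1)%type.
Definition node := ('I_e.+1 * 'I_(2 ^ e).-1.+1)%type.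
Definition ivar := (bvar + node)%type.

Definition num (v : ivar) : nat := enum_rank v.

Lemma num_inj : injective num.
Proof. by move=> v w /ord_inj/enum_rank_inj. Qed.

Definition num_lit (l : ivar * bool) : lit := (num l.1, l.2).

Definition tree_var (k x : nat) : ivar := inr (inord k, inord x).
Definition bit_var (k : nat) : ivar := inl (inr (inord k)).
Definition word_var (j : nat) : ivar := inl (inl (input_var M T j)).

(** For s < e, bit s is counted from the most significant end, so the prefix of length k + 1 is
    twice the prefix of length k plus bit k. *)
Definition intended (i : nat) (u y : seq bool) (v : ivar) : bool :=
  match v with
  | inl (inl w) => hist_val u y w
  | inl (inr s) => odd (i %/ 2 ^ (e - s.+1))
  | inr (k, x) => x == i %/ 2 ^ (e - k) :> nat
  end.

Definition is_node (l : ivar * bool) : bool := if l.1 is inr _ then true else false.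

(* Once the backdoor is assigned, only node literals remain. *)
Definition admissible (C : seq (ivar * bool)) : bool :=
  (count is_node C <= 2) && (count (fun l => is_node l && l.2) C <= 1).

Definition ivalid (C : seq (ivar * bool)) : Prop :=
  forall i u y, i < 2 ^ e -> accepting f n q u y -> sat_clause (intended i u y) C.

(** Validity is decided by excluded middle, which is harmless in advice. These clauses do not
    mention the t words. *)
Definition fixed_clauses : seq (seq (ivar * bool)) :=
  [seq bseqval C | C : 3.-bseq (ivar * bool) <- enum {: 3.-bseq (ivar * bool)} & admissible C && asbool (ivalid C)].

(* Words are stored reversed, in the order in which the verifying machine pops its input. *)
Definition word_clause (us : nat -> seq bool) (i j : nat) : seq (ivar * bool) :=
  [:: (tree_var e i, false); (word_var (n - j.+1), nth false (us i) j)].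

Definition word_clauses (us : nat -> seq bool) : seq (seq (ivar * bool)) :=
  [seq word_clause us i j | i <- iota 0 (2 ^ e), j <- iota 0 n].

Definition formula (us : nat -> seq bool) : cnf :=
  [seq map num_lit C | C <- word_clauses us ++ fixed_clauses].

Definition backdoor : seq nat := [seq num (inl v) | v <- enum {: bvar}].

Lemma uniq_backdoor : uniq backdoor.
Proof. by rewrite map_inj_uniq ?enum_uniq // => v w /num_inj[]. Qed.

Lemma size_backdoor : size backdoor = #|{: bvar}|.
Proof. by rewrite size_map -cardE. Qed.

Lemma num_backdoor v : (num v \in backdoor) = if v is inl _ then true else false.
Proof.
case: v => v.
  by rewrite (map_f (fun v => num (inl v))) // mem_enum.
by apply/negP => /mapP[w _ /num_inj].
Qed.

Lemma fixed_clausesP C :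
  reflect [/\ size C <= 3, admissible C & ivalid C] (C \in fixed_clauses).
Proof.
apply: (iffP mapP) => [[D + ->]|[szC aC vC]].
  by rewrite mem_filter => /andP[/andP[aD /asboolP vD] _]; split=> //; exact: size_bseq.
exists (Bseq szC) => //; rewrite mem_filter mem_enum /= aC /= andbT.
exact/asboolP.
Qed.

Lemma word_clausesP us C :
  reflect (exists i j, [/\ i < 2 ^ e, j < n & C = word_clause us i j]) (C \in word_clauses us).
Proof.
apply: (iffP allpairsP) => [[[i j] [/= + + ->]]|[i [j [lti ltj ->]]]].
  by rewrite !mem_iota; exists i, j.
by exists (i, j); rewrite /= !mem_iota.
Qed.

Lemma formula_clause us C : C \in formula us -> exists D : seq (ivar * bool),
  [/\ C = map num_lit D, size D <= 3 & admissible D].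
Proof.
case/mapP => D + ->; rewrite mem_cat.
case/orP => [/word_clausesP[i [j [_ _ ->]]]|/fixed_clausesP[szD aD _]]; last by exists D.
by exists (word_clause us i j).
Qed.

Lemma formula_3CNF us : is3CNF (formula us).
Proof.
apply/allP => C /formula_clause[D [-> szD _]].
by rewrite (leq_trans (size_undup _)) // size_map.
Qed.

(** What survives in a clause is exactly its node literals, and [admissible] counts those. *)
Lemma reduce_light us tau : all light (reduce (formula us) backdoor tau).
Proof.
apply/allP => C /mapP[E]; rewrite mem_filter => /andP[_ /formula_clause[D [-> _ /andP[le2 le1]]]] ->.
rewrite filter_map /light size_map count_map.
have eqP l : (preim num_lit (fun l : lit => l.1 \notin backdoor)) l = is_node l.
  by rewrite /= num_backdoor /is_node; case: l => [[v|v] b].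
rewrite (eq_filter eqP) size_filter le2 /=.
rewrite count_filter; apply: leq_trans le1; apply: sub_count => l /=.
by rewrite andbC.
Qed.

Lemma sat_clause_num (alpha : nat -> bool) (C : seq (ivar * bool)) :
  has (fun l : lit => alpha l.1 == l.2) (map num_lit C) = sat_clause (alpha \o num) C.
Proof. by rewrite has_map. Qed.

Lemma inord_pow x : x < 2 ^ e -> (inord x : 'I_(2 ^ e).-1.+1) = x :> nat.
Proof. by move=> lt; rewrite inordK // prednK // expn_gt0. Qed.

Lemma satisfiable_intro us i y : i < 2 ^ e -> (forall i, size (us i) = n) ->
  accepting f n q (rev (us i)) y -> satisfiable (formula us).
Proof.
move=> lti szus acc; set u := rev (us i) in acc.
pose alpha k := if insub k is Some r then intended i u y (enum_val (r : 'I_#|{: ivar}|)) else false.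
have alphaE v : (alpha \o num) v = intended i u y v.
  by rewrite /= /alpha /num valK enum_rankK.
exists alpha; apply/allP => C /mapP[D + ->]; rewrite sat_clause_num.
rewrite /sat_clause (eq_has (a2 := fun l => intended i u y l.1 == l.2)); last first.
  by move=> l; rewrite /= -alphaE.
rewrite mem_cat => /orP[/word_clausesP[i' [j [lti' ltj ->]]]|/fixed_clausesP[_ _]]; last exact.
rewrite /= (inordK (ltnSn e)) subnn divn1 inord_pow //.
(* Word clauses of other indices hold because their leaf is false. *)
case: (i' =P i) => [->|//] /=.
rewrite (hist_val_input M T_input T_time) ?size_rev //; last by lia.
by rewrite nth_rev szus; [rewrite subnSK // subKn ?eqxx // ltnW | lia].
Qed.

(** Valid tableau clauses have no node literal, so they are all among the fixed clauses and yield an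
    accepted word. The selector bits lead down the tree to a true leaf, whose word clauses identify
    that word. *)
Lemma satisfiable_elim us : (forall i, size (us i) = n) -> satisfiable (formula us) ->
  exists i y, i < 2 ^ e /\ accepting f n q (rev (us i)) y.
Proof.
move=> szus [alpha /allP sat_alpha]; pose beta := alpha \o num.
have word_sat i j : i < 2 ^ e -> j < n -> sat_clause beta (word_clause us i j).
  move=> lti ltj; rewrite -sat_clause_num; apply: sat_alpha; apply: map_f.
  by rewrite mem_cat; apply/orP; left; apply/word_clausesP; exists i, j.
have fixed_sat C : size C <= 3 -> admissible C -> ivalid C -> sat_clause beta C.
  move=> szC aC vC; rewrite -sat_clause_num; apply: sat_alpha; apply: map_f.
  by rewrite mem_cat; apply/orP; right; apply/fixed_clausesP.
have [|u [y [acc uE]]] := tableau_sound M_computes T_input T_time (alpha := fun v => beta (inl (inl v))).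
  move=> C szC vC.
  have := fixed_sat [seq (inl (inl l.1), l.2) | l <- C].
  rewrite /sat_clause has_map size_map; apply=> //.
    by rewrite /admissible !count_map !(eq_count (a2 := pred0)) ?count_pred0.
  by move=> i u y _ acc; rewrite /sat_clause has_map; exact: vC acc.
have path k : k <= e -> exists2 x, x < 2 ^ k & beta (tree_var k x).
  elim: k => [|k IHk] lek.
    exists 0; rewrite ?expn0 //.
    have := fixed_sat [:: (tree_var 0 0, true)].
    rewrite /sat_clause /= orbF eqb_id; apply=> // i u' y' lti _.
    by rewrite /sat_clause /= !inordK // subn0 divn_small.
  have [x ltx bx] := IHk (ltnW lek); set b := beta (bit_var k).
  have lt2x : x.*2 + b < 2 ^ k.+1 by rewrite expnS; case: (b); lia.
  have le2 m : m <= e -> 2 ^ m <= 2 ^ e by move=> ?; rewrite leq_exp2l.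
  exists (x.*2 + b) => //.
  (* A true node together with bit k makes the corresponding child true. Of the two node literals
     only one is positive, so the clause is admissible. *)
  have := fixed_sat [:: (tree_var k x, false); (bit_var k, ~~ b); (tree_var k.+1 (x.*2 + b), true)].
  rewrite /sat_clause /= bx -/b orbF eqb_id /=; case: eqP => [|_ /=]; first by case: (b).
  have ltk : k < e.+1 by rewrite ltnS ltnW.
  apply=> // i u' y' lti _; rewrite /sat_clause /= (inordK ltk) (inordK (lek : k.+1 < e.+1)).
  rewrite (inord_pow (leq_trans ltx (le2 _ (ltnW lek)))) (inord_pow (leq_trans lt2x (le2 _ lek))).
  rewrite orbF eqb_id.
  have -> : i %/ 2 ^ (e - k) = (i %/ 2 ^ (e - k.+1))./2.
    by rewrite -divn2 -divnMA -expnSr; congr (_ %/ 2 ^ _); lia.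
  move: (i %/ _) => m; case: (x =P m./2) => [->|//] /=.
  case E: (odd m); case: (b) => //=; rewrite -{2}(odd_double_half m) E; lia.
have [i lti bi] := path e (leqnn e).
exists i, y; split=> //.
have -> : rev (us i) = u; last exact: acc.
case: (acc) => szu _ _.
apply: (@eq_from_nth _ false); first by rewrite size_rev szus.
move=> j; rewrite size_rev szus => ltj; rewrite uE // nth_rev szus //.
have ltj' : n - j.+1 < n by lia.
have := word_sat i _ lti ltj'; rewrite /sat_clause /= bi orbF.
by rewrite subnSK // subKn 1?ltnW // => /eqP <-.
Qed.

End Instance.

(** * Instances as templates *)

Lemma unpair_pair_enc x y acc : unpair (pair_enc x y) acc = Some (catrev x acc, y).
Proof. by elim: x acc => [|b x IHx] acc //=; rewrite eqxx -IHx. Qed.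

Definition list_code (A : seq (seq bool)) : seq bool :=
  flatten [seq rcons (flatten [seq [:: true; b] | b <- a]) false | a <- A].

Lemma skip_code a v : skip (rcons (flatten [seq [:: true; b] | b <- a]) false ++ v) = Some v.
Proof. by elim: a. Qed.

Lemma matches_code a v o :
  matches (rcons (flatten [seq [:: true; b] | b <- a]) false ++ v) o = (o == a).
Proof.
elim: a o => [|b a IHa] [|b' o] //=.
by rewrite IHa eqseq_cons eq_sym.
Qed.

Lemma lookup_sound y A o : lookup y (list_code A) o -> o \in A.
Proof.
elim: y A => [|[] y IHy] [|a A] //=; rewrite /list_code /=.
  by rewrite matches_code => /eqP->; rewrite mem_head.
by rewrite skip_code => /IHy oA; rewrite inE oA orbT.
Qed.

Lemma lookup_complete A o : o \in A -> exists2 y, size y <= size A & lookup y (list_code A) o.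
Proof.
elim: A => // a A IHA; rewrite inE; case: (eqVneq o a) => [-> _|_ /= /IHA[y szy yo]].
  by exists [:: true] => //=; rewrite /list_code /= matches_code.
by exists (false :: y) => //=; rewrite /list_code /= skip_code.
Qed.

Section Template.

Variables (t n : nat) (pre : nat -> seq bool) (post : nat -> seq bool) (tail : seq bool).

Definition filled (i : nat) (xs : seq bool) (js : seq nat) : seq bool :=
  flatten [seq pre i ++ p.1 :: post p.2 | p <- zip xs js].

(** The blocks belong to the first component of a pair and are doubled by [pair_enc]; this is why a
    hole emits its bit twice. *)
Definition output_text (us : nat -> seq bool) : seq bool :=
  dbl (flatten [seq filled i (us i) (iota 0 n) | i <- iota 0 t]) ++ tail.

Definition emit (s : seq bool) : seq bool := flatten [seq [:: false; b] | b <- s].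

Definition hole_code (i j : nat) : seq bool :=
  emit (dbl (pre i)) ++ [:: true; true; false] ++ emit (dbl (post j)).

Definition holes_code (i : nat) (js : seq nat) : seq bool := flatten [seq hole_code i j | j <- js].

Definition block_code (i : nat) : seq bool := [:: true; false] ++ holes_code i (iota 0 n).

Definition blocks (is_ : seq nat) : seq bool := flatten [seq block_code i | i <- is_].

Arguments blocks : simpl never.

Lemma blocks_cons i is_ v :
  blocks (i :: is_) ++ v = [:: true, false & holes_code i (iota 0 n) ++ blocks is_ ++ v].
Proof. exact: (congr1 (fun s => [:: true, false & s]) (esym (catA _ _ _))). Qed.

Definition template : seq bool :=
  blocks (iota 0 t) ++ emit tail ++ [:: true; true; true].

Lemma dbl_cat s s' : dbl (s ++ s') = dbl s ++ dbl s'.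
Proof. by rewrite /dbl map_cat flatten_cat. Qed.

Lemma gen_emit s v m x y w : gen (emit s ++ v) m x y w = gen v m x y (catrev s w).
Proof. by elim: s w => //= b s IHs w; rewrite IHs. Qed.

Lemma catrev_cat (s s' w : seq bool) : catrev (s ++ s') w = catrev s' (catrev s w).
Proof. by elim: s w => //=. Qed.

(** The mode is constant within a block, so all its holes are filled from a prefix of one source. *)
Lemma gen_holes i js v m x y w :
  gen (holes_code i js ++ v) m x y w =
  let k := size js in
  if m then (if k <= size x then
               gen v m (drop k x) y (catrev (dbl (filled i (take k x) js)) w) else None)
  else (if k <= size y then
          gen v m x (drop k y) (catrev (dbl (filled i (take k y) js)) w) else None).
Proof.
elim: js x y w => [|j js IHjs] x y w; first by rewrite /= !take0 !drop0 /filled /=; case: m.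
rewrite /holes_code /= -/(holes_code i js) /hole_code -!catA gen_emit.
case: m IHjs => IHjs.
  case: x => [|b x] //=; rewrite gen_emit IHjs /= ltnS; case: (size js <= size x) => //.
  by rewrite /filled /= -/(filled i _ js) !dbl_cat !catrev_cat.
case: y => [|b y] //=; rewrite gen_emit IHjs /= ltnS; case: (size js <= size y) => //.
by rewrite /filled /= -/(filled i _ js) !dbl_cat !catrev_cat.
Qed.

Lemma gen_tail A m x y w :
  gen (emit tail ++ [:: true; true; true] ++ A) m x y w = Some (A, x, y, catrev tail w).
Proof. by rewrite gen_emit. Qed.

Definition output_from (us : nat -> seq bool) (is_ : seq nat) (w : seq bool) : seq bool :=
  catrev tail (catrev (dbl (flatten [seq filled i (us i) (iota 0 n) | i <- is_])) w).

(* Reading [x] inside a block consumes it entirely, so at most one block copies [x]. *)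
Lemma gen_blocks_sound a l A m x y w A' x' y' w' :
  size x = n \/ x = [::] ->
  gen (blocks (iota a l) ++ emit tail ++ [:: true; true; true] ++ A) m x y w
    = Some (A', x', y', w') ->
  exists us : nat -> seq bool, [/\ forall i, size (us i) = n, A' = A,
    w' = output_from us (iota a l) w
  & x' = x \/ x' = [::] /\ exists i, a <= i < a + l /\ us i = x].
Proof.
elim: l a m x y w => [|l IHl] a m x y w szx.
  rewrite gen_tail => -[<- <- _ <-]; exists (fun _ => nseq n false).
  by split=> // [i|]; [rewrite size_nseq | left].
rewrite [iota a _]/= blocks_cons.
case: y => // m' y; rewrite [gen _ _ _ _ _]/= gen_holes /= size_iota.
have extend us b wa (H : [/\ forall i, size (us i) = n, A' = A,
    w' = output_from us (iota a.+1 l) wa & True]) : size b = n ->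
    wa = catrev (dbl (filled a b (iota 0 n))) w ->
    [/\ forall i, size (if i == a then b else us i) = n, A' = A
      & w' = output_from (fun i => if i == a then b else us i) (iota a l.+1) w].
  case: H => szus -> -> _ szb ->; split=> //; first by move=> i; case: eqP.
  rewrite /output_from /= dbl_cat catrev_cat eqxx; congr (catrev _ (catrev (dbl (flatten _)) _)).
  apply/eq_in_map => i; rewrite mem_iota; case: eqP => // ->; lia.
case: m' => /=; case: leqP => // len.
- have xn : size x = n by case: szx len => // -> /=; lia.
  rewrite take_oversize ?drop_oversize ?xn // => /IHl[|us [szus eA ew ex]]; first by right.
  have [szus' eA' ew'] := extend us x _ (And4 szus eA ew I) xn erefl.
  exists (fun i => if i == a then x else us i); split=> //.
  right; split; first by case: ex => // -[].
  by exists a; rewrite eqxx; split=> //; lia.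
move=> /IHl[//|us [szus eA ew ex]].
have szy : size (take n y) = n by rewrite size_takel.
have [szus' eA' ew'] := extend us (take n y) _ (And4 szus eA ew I) szy erefl.
exists (fun i => if i == a then take n y else us i); split=> //.
case: ex => [->|[-> [i [lei usi]]]]; [by left | right; split=> //; exists i].
have -> : (i == a) = false by apply/negP => /eqP ei; move: lei; rewrite ei ltnn.
by split=> //; lia.
Qed.

Lemma gen_blocks_free us A y is_ m x w : (forall i, size (us i) = n) ->
  gen (blocks is_ ++ emit tail ++ [:: true; true; true] ++ A) m x
      (flatten [seq false :: us i | i <- is_] ++ y) w
    = Some (A, x, y, output_from us is_ w).
Proof.
move=> szus; elim: is_ m w => [|i is_ IH] m w; first exact: gen_tail.
rewrite blocks_cons /= gen_holes /= size_iota.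
rewrite -(catA (us i)) size_cat szus leq_addr /= take_size_cat // drop_size_cat // IH.
by rewrite /output_from dbl_cat catrev_cat.
Qed.

(** The certificate marks block [i0] by [true] and spells out every other word after a [false], at a
    cost of at most n + 1 bits per block. *)
Lemma gen_blocks_complete us A y is_ m w i0 : (forall i, size (us i) = n) -> i0 \in is_ -> uniq is_ ->
  exists2 ys, size ys <= n.+1 * size is_ &
  gen (blocks is_ ++ emit tail ++ [:: true; true; true] ++ A) m (us i0)
      (ys ++ y) w
    = Some (A, [::], y, output_from us is_ w).
Proof.
move=> szus; elim: is_ m w => // i is_ IH m w; rewrite inE cons_uniq => i0is /andP[inis uniq_is].
case: (eqVneq i0 i) i0is => [-> _|_ i0is].
  exists (true :: flatten [seq false :: us i | i <- is_]).
    rewrite /= size_flatten /shape -map_comp (eq_map (g := fun=> n.+1)); last first.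
      by move=> k; rewrite /= szus.
    have -> : sumn [seq n.+1 | _ <- is_] = n.+1 * size is_ by elim: (is_) => [|k s]; rewrite ?muln0 //= mulnS => ->.
    by rewrite mulnS addSn ltnS leq_addl.
  rewrite blocks_cons /= gen_holes /= size_iota szus leqnn.
  rewrite -{1 2}(szus i) drop_size take_size gen_blocks_free //.
  by rewrite /output_from /= dbl_cat catrev_cat.
have [ys szys gen_ys] := IH false (catrev (dbl (filled i (us i) (iota 0 n))) w) i0is uniq_is.
exists ((false :: us i) ++ ys); first by rewrite size_cat /= szus mulnS leq_add2l.
rewrite -catA blocks_cons /= gen_holes /= size_iota size_cat szus leq_addr.
rewrite take_size_cat // drop_size_cat // gen_ys.
by rewrite /output_from /= dbl_cat catrev_cat.
Qed.

Variables (f : seq bool -> seq bool) (A : seq (seq bool)).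

Definition advice : seq bool := template ++ list_code A.

Lemma verify_advice x y : verify f (pair_enc (pair_enc x advice) y) =
  if gen advice false (rev x) y [::] is Some (v', x', y', w) then
    (x' == [::]) && lookup y' v' (f (rev w))
  else false.
Proof. by rewrite /verify unpair_pair_enc catrev_nil revK unpair_pair_enc catrev_nil. Qed.

Lemma output_fromE us : rev (output_from us (iota 0 t) [::]) = output_text us.
Proof. by rewrite /output_from /output_text !catrevE cats0 rev_cat !revK. Qed.

Lemma verify_sound x y : size x = n -> 0 < t ->
  verify f (pair_enc (pair_enc x advice) y) ->
  exists us : nat -> seq bool, [/\ forall i, size (us i) = n,
    exists i, i < t /\ us i = rev x & f (output_text us) \in A].
Proof.
move=> szx t_gt0; rewrite verify_advice /advice /template -!catA.
case E: gen => [[[[v' x'] y'] w]|] // /andP[/eqP x'0].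
have szrx : size (rev x) = n \/ rev x = [::] by left; rewrite size_rev.
have [us [szus -> -> x'E]] := gen_blocks_sound szrx E.
rewrite output_fromE => /lookup_sound fA; exists us; split=> //.
case: x'E => [e0|[_ [i [lti usi]]]]; last by exists i; split=> //; lia.
(* If no block copied the input, then the input is empty, all words are empty, and block 0 contains
   it. *)
have rx0 : rev x = [::] by rewrite -e0.
by exists 0; split=> //; rewrite rx0; apply: size0nil; rewrite szus -szx -(size_rev x) rx0.
Qed.

Lemma verify_complete us i x : (forall i, size (us i) = n) -> i < t -> us i = rev x ->
  f (output_text us) \in A ->
  exists2 y, size y <= n.+1 * t + size A & verify f (pair_enc (pair_enc x advice) y).
Proof.
move=> szus lti usi /lookup_complete[yl szyl lookup_yl].
have it : i \in iota 0 t by rewrite mem_iota.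
have [ys szys gen_ys] :=
  gen_blocks_complete (list_code A) yl false [::] szus it (iota_uniq 0 t).
exists (ys ++ yl); first by rewrite size_cat leq_add //; move: szys; rewrite size_iota.
by rewrite verify_advice /advice /template -!catA -usi gen_ys output_fromE.
Qed.

End Template.

(** * Polynomial bounds *)

Definition poly_bounded (g : nat -> nat) : Prop := exists c d, forall n, g n <= c * n.+1 ^ d.

Lemma poly_bounded_leq g h : (forall n, g n <= h n) -> poly_bounded h -> poly_bounded g.
Proof. by move=> gh [c [d hb]]; exists c, d => n; exact: leq_trans (gh n) (hb n). Qed.

Lemma poly_bounded_const k : poly_bounded (fun=> k).
Proof. by exists k, 0 => n; rewrite expn0 muln1. Qed.

Lemma poly_bounded_id : poly_bounded id.
Proof. by exists 1, 1 => n; rewrite expn1 mul1n. Qed.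

Lemma poly_bounded_add g h :
  poly_bounded g -> poly_bounded h -> poly_bounded (fun n => g n + h n).
Proof.
move=> [c [d gb]] [c' [d' hb]]; exists (c + c'), (d + d') => n.
rewrite mulnDl leq_add //.
  apply: leq_trans (gb n) _; rewrite leq_mul2l leq_pexp2l ?orbT //; lia.
apply: leq_trans (hb n) _; rewrite leq_mul2l leq_pexp2l ?orbT //; lia.
Qed.

Lemma poly_bounded_mul g h :
  poly_bounded g -> poly_bounded h -> poly_bounded (fun n => g n * h n).
Proof.
move=> [c [d gb]] [c' [d' hb]]; exists (c * c'), (d + d') => n.
by rewrite expnD mulnACA leq_mul.
Qed.

Lemma poly_bounded_exp g k : poly_bounded g -> poly_bounded (fun n => g n ^ k).
Proof.
move=> [c [d gb]]; exists (c ^ k), (d * k) => n.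
by rewrite expnM -expnMn; case: k => // k; rewrite leq_exp2r.
Qed.

Lemma poly_bounded_succ g : poly_bounded g -> poly_bounded (fun n => (g n).+1).
Proof.
move=> gb; apply: (poly_bounded_leq (h := fun n => g n + 1)); first by move=> n; rewrite addn1.
by apply: poly_bounded_add => //; exact: poly_bounded_const.
Qed.

Lemma poly_bounded_comp g h : poly_bounded h -> poly_bounded g -> poly_bounded (fun n => h (g n)).
Proof.
move=> [c [d hb]] gb; apply: (poly_bounded_leq (fun n => hb (g n))).
apply: poly_bounded_mul; first exact: poly_bounded_const.
exact/poly_bounded_exp/poly_bounded_succ.
Qed.

Ltac poly_bound :=
  repeat first [ assumption | apply: poly_bounded_const | apply: poly_bounded_id
    | apply: poly_bounded_add | apply: poly_bounded_mul | apply: poly_bounded_exp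
    | apply: poly_bounded_succ ].

Lemma exp_dominates_poly A B k : exists c0, A * (c0 + B) ^ k + 3 <= 2 ^ c0.
Proof.
(* The number z exceeds all data, so c0 + B is at most z ^ 2 and the left side at most z ^ (2k + 1),
   whereas 2 ^ c0 = (2 ^ z) ^ (2k + 2). *)
pose z := A + B + k.*2 + 5; pose c0 := k.+1.*2 * z; exists c0.
have lt_z : z < 2 ^ z by exact: ltn_expl.
have leX : (c0 + B) ^ k <= z ^ k.*2.
  have le2 : c0 + B <= z ^ 2.
    by rewrite expnS expn1 /c0 doubleS; have : B + k.*2 + 3 <= z by [rewrite /z; lia]; nia.
  by rewrite -mul2n expnM; case: (k) => // k'; rewrite leq_exp2r.
have X_gt0 : 0 < z ^ k.*2 by rewrite expn_gt0 /z addnS.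
have le1 : A * (c0 + B) ^ k + 3 <= z ^ k.*2.+1.
  by rewrite expnS; move: leX X_gt0; set X := _ ^ k; set Y := _ ^ _; rewrite /z; nia.
apply: leq_trans le1 _; apply: (@leq_trans (z ^ k.+1.*2)).
  by rewrite leq_pexp2l // /z addnS.
by rewrite /c0 mulnC expnM leq_exp2r // ltnW.
Qed.

(* The selector bits are themselves counted in the parameter, hence the self-referential bound. *)
Lemma selector_length kc kd : exists e : nat -> nat,
  (forall v, 2 * (kc * (v + (e v).+1).+1 ^ kd) + 3 <= 2 ^ e v) /\
  poly_bounded (fun v => 2 ^ e v).
Proof.
have [c0 c0P] := exp_dominates_poly (2 * kc) (kd + 3) kd.
(* Here 2 ^ a is of the order of v: the factor (2 ^ a) ^ kd absorbs the growth in v and remains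
   polynomial, while 2 ^ c0 absorbs the constants. *)
pose a v := (trunc_log 2 v.+1).+1; exists (fun v => a v * kd + c0).
have av v : v.+1 < 2 ^ a v by exact: trunc_log_ltn.
have va v : 2 ^ a v <= 2 * v.+1.
  by rewrite expnS leq_mul2l /=; apply: trunc_logP.
split=> [v|]; last first.
  apply: (poly_bounded_leq (h := fun v => (2 * v.+1) ^ kd * 2 ^ c0)).
    move=> v; rewrite expnD expnM leq_mul2r; apply/orP; right.
    by case: (kd) => // k; rewrite leq_exp2r.
  by poly_bound.
have lt_a : a v < 2 ^ a v by exact: ltn_expl.
have le_base : (v + (a v * kd + c0).+1).+1 <= 2 ^ a v * (c0 + (kd + 3)).
  by move: (av v) lt_a; set y := 2 ^ _; set x := a v; nia.
have le_exp : (v + (a v * kd + c0).+1).+1 ^ kd <= (2 ^ a v) ^ kd * (c0 + (kd + 3)) ^ kd.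
  by rewrite -expnMn; case: (kd) le_base => // k le; rewrite leq_exp2r.
rewrite expnD expnM; have y_gt0 : 0 < (2 ^ a v) ^ kd by rewrite !expn_gt0.
move: c0P le_exp y_gt0; set Y := (2 ^ a v) ^ kd; set X := (c0 + (kd + 3)) ^ kd.
set W := _ ^ kd; set Z := 2 ^ c0 => h1 h2 h3; nia.
Qed.

Lemma size_flatten_leq (S : eqType) (g : S -> seq bool) b (s : seq S) :
  (forall x, x \in s -> size (g x) <= b) -> size (flatten (map g s)) <= size s * b.
Proof.
elim: s => // x s IHs gb; rewrite /= size_cat mulSn leq_add ?gb ?mem_head //.
by apply: IHs => y ys; rewrite gb // inE ys orbT.
Qed.

Lemma size_enc_nat v : size (enc_nat v) <= 3 * v + 3.
Proof.
rewrite /enc_nat size_cat leq_add2r.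
apply: (@leq_trans (size (bits v) * 3)); last by rewrite mulnC leq_mul2l size_bits_fuel orbT.
by apply: size_flatten_leq => -[].
Qed.

Lemma size_enc_lit l : size (enc_lit l) <= 3 * l.1 + 6.
Proof. by rewrite /enc_lit size_cat; have := size_enc_nat l.1; case: l.2; rewrite /=; lia. Qed.

Lemma size_emit s : size (emit s) = 2 * size s.
Proof. by elim: s => //= b s; rewrite /emit => ->; lia. Qed.

Lemma size_list_code A m : (forall a, a \in A -> size a <= m) ->
  size (list_code A) <= size A * (2 * m + 1).
Proof.
move=> Am; apply: size_flatten_leq => a /Am le_am; rewrite size_rcons.
have -> : size (flatten [seq [:: true; b] | b <- a]) = 2 * size a.
  by elim: (a) => //= b s ->; lia.
by lia.
Qed.

Lemma size_list_code_geq A : size A <= size (list_code A).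
Proof. by elim: A => //= a A IHA; rewrite size_cat size_rcons -addn1 addnC leq_add. Qed.

(** * The instance text, split around its isolated bits *)

Section InstanceSize.

Variables (M : tm) (f : seq bool -> seq bool) (n q T e : nat).

Local Notation N := (#|{: ivar M T e}|).
Local Notation fixed := (fixed_clauses M f n q T e).

(** The two sign tokens differ only in their third bit; [[:: false; false]] is their common
    beginning, and the hole supplies the sign of the second literal. *)
Definition word_prefix (i : nat) : seq bool :=
  enc_lit (num (tree_var M T e e i), false) ++ [:: false; false].
Definition word_suffix (j : nat) : seq bool :=
  enc_nat (num (word_var M T e (n - j.+1))) ++ tok_endclause.
Definition fixed_text : seq bool :=
  flatten [seq enc_clause C | C <- [seq map (@num_lit M T e) C | C <- fixed]] ++ tok_endformula
    ++ flatten [seq enc_nat v | v <- backdoor M T e].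
Definition fixed_tail : seq bool :=
  dbl fixed_text ++ [:: false; true] ++ nseq (size (backdoor M T e)) true.

Lemma word_clause_code us i j :
  enc_clause (map (@num_lit M T e) (word_clause M n T e us i j)) =
  word_prefix i ++ nth false (us i) j :: word_suffix j.
Proof.
rewrite /word_prefix -catA.
change (enc_clause (map (@num_lit M T e) (word_clause M n T e us i j))) with
  ((enc_lit (num (tree_var M T e e i), false) ++
   (enc_lit (num (word_var M T e (n - j.+1)), nth false (us i) j) ++ [::])) ++ tok_endclause).
rewrite cats0 -(catA (enc_lit _)); congr (_ ++ _).
by rewrite /word_suffix /enc_lit -catA; case: (nth _ _ _).
Qed.

Lemma output_text_inst us : (forall i, size (us i) = n) ->
  output_text (2 ^ e) n word_prefix word_suffix fixed_tail us =
  enc_pk (enc_inst (formula M f n q T e us) (backdoor M T e)) (size (backdoor M T e)).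
Proof.
move=> szus; rewrite /enc_pk /pair_enc -/(dbl _) /output_text /fixed_tail catA -dbl_cat.
congr (dbl _ ++ _); rewrite /enc_inst /enc_cnf /formula map_cat map_cat flatten_cat -!catA.
congr (_ ++ _); rewrite -map_comp /word_clauses; elim: (iota 0 (2 ^ e)) => // i s IHs.
rewrite [map _ _]/= [flatten _]/= IHs /= map_cat flatten_cat; congr (_ ++ _).
have -> : filled word_prefix word_suffix i (us i) (iota 0 n) =
  flatten [seq word_prefix i ++ nth false (us i) j :: word_suffix j | j <- iota 0 n].
  rewrite /filled -{1}(mkseq_nth false (us i)) szus /mkseq -{2}(map_id (iota 0 n)).
  by rewrite zip_map -map_comp.
by rewrite -map_comp; congr flatten; apply: eq_map => j; rewrite -[LHS]word_clause_code.
Qed.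

End InstanceSize.

(** * From a polynomial kernel to advice *)

Lemma size_hole_code pre post i j :
  size (hole_code pre post i j) = 4 * size (pre i : seq bool) + 3 + 4 * size (post j : seq bool).
Proof. by rewrite /hole_code !size_cat !size_emit !size_dbl /=; lia. Qed.

Section TemplateSize.

Variables (M : tm) (f : seq bool -> seq bool) (n q T e : nat).

Local Notation N := (#|{: ivar M T e}|).

Lemma num_lt (v : ivar M T e) : num v < N.
Proof. exact: ltn_ord. Qed.

Lemma size_word_prefix i : size (word_prefix M T e i) <= 3 * N + 8.
Proof.
rewrite /word_prefix size_cat /=.
have := size_enc_lit (num (tree_var M T e e i), false).
by have := num_lt (tree_var M T e e i); rewrite /=; lia.
Qed.

Lemma size_word_suffix j : size (word_suffix M n T e j) <= 3 * N + 6.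
Proof.
rewrite /word_suffix size_cat /=.
have := size_enc_nat (num (word_var M T e (n - j.+1))).
by have := num_lt (word_var M T e (n - j.+1)); lia.
Qed.

Lemma size_fixed : size (fixed_clauses M f n q T e) <= 4 * (2 * N).+1 ^ 3.
Proof.
rewrite /fixed_clauses size_map size_filter.
apply: leq_trans (count_size _ _) _; rewrite -cardE card_bseq.
have -> : 4 * (2 * N).+1 ^ 3 = \sum_(i < 4) (2 * N).+1 ^ 3 by rewrite sum_nat_const card_ord.
apply: leq_sum => i _; rewrite card_prod card_bool mulnC.
apply: (@leq_trans ((2 * N).+1 ^ i)); last by rewrite leq_pexp2l // -ltnS.
by case: (i : nat) => // k; rewrite leq_exp2r.
Qed.

Lemma size_backdoor_leq : size (backdoor M T e) <= N.
Proof. by rewrite size_backdoor [X in _ <= X]card_sum leq_addr. Qed.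

Definition fixed_bound (N : nat) : nat :=
  2 * (4 * (2 * N).+1 ^ 3 * (3 * (3 * N + 6) + 3) + (3 + N * (3 * N + 3))) + (2 + N).

Lemma size_fixed_tail : size (fixed_tail M f n q T e) <= fixed_bound N.
Proof.
rewrite /fixed_tail !size_cat size_nseq size_dbl /fixed_bound leq_add //; last first.
  by rewrite leq_add2l size_backdoor_leq.
rewrite leq_mul2l /fixed_text !size_cat leq_add //.
  apply: (@leq_trans (size (fixed_clauses M f n q T e) * (3 * (3 * N + 6) + 3))); last first.
    by rewrite leq_mul2r size_fixed orbT.
  rewrite -map_comp; apply: size_flatten_leq => C /fixed_clausesP[szC _ _].
  rewrite /= /enc_clause size_cat leq_add2r -map_comp.
  apply: (@leq_trans (size C * (3 * N + 6))); last by rewrite leq_mul2r szC orbT.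
  apply: size_flatten_leq => l _; rewrite /= (leq_trans (size_enc_lit _)) //.
  by rewrite leq_add2r leq_mul2l /= ltnW // num_lt.
rewrite leq_add2l; apply: (@leq_trans (size (backdoor M T e) * (3 * N + 3))).
  apply: size_flatten_leq => v /mapP[w _ ->]; rewrite (leq_trans (size_enc_nat _)) //.
  by rewrite leq_add2r leq_mul2l /= ltnW // num_lt.
by rewrite leq_mul2r size_backdoor_leq orbT.
Qed.

Definition template_bound (t n N : nat) : nat :=
  t * (2 + n * (4 * (3 * N + 8) + 3 + 4 * (3 * N + 6))) + (2 * fixed_bound N + 3).

Local Notation tpl :=
  (template (2 ^ e) n (word_prefix M T e) (word_suffix M n T e) (fixed_tail M f n q T e)).

Lemma size_template : size tpl <= template_bound (2 ^ e) n N.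
Proof.
rewrite /template !size_cat /template_bound leq_add //.
  rewrite -{2}(size_iota 0 (2 ^ e)); apply: size_flatten_leq => i _.
  rewrite /block_code size_cat leq_add2l -{3}(size_iota 0 n).
  apply: size_flatten_leq => j _; rewrite size_hole_code.
  by have := size_word_prefix i; have := size_word_suffix j; lia.
by rewrite leq_add2r size_emit leq_mul2l size_fixed_tail.
Qed.

(** Certificates must be polynomially short in the length of the input with its advice. They take n
    + 1 bits per block, so the advice has to be at least as long as the number of blocks. *)
Lemma size_template_geq : 2 ^ e <= size tpl.
Proof.
rewrite /template size_cat -{1}(size_iota 0 (2 ^ e)) -[X in X <= _]addn0 leq_add //.
rewrite /blocks; elim: (iota 0 (2 ^ e)) => // i s IHs.
have -> : flatten [seq block_code n (word_prefix M T e) (word_suffix M n T e) k | k <- i :: s] =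
  block_code n (word_prefix M T e) (word_suffix M n T e) i
    ++ flatten [seq block_code n (word_prefix M T e) (word_suffix M n T e) k | k <- s] by [].
by rewrite size_cat -[size (i :: s)]add1n leq_add.
Qed.

End TemplateSize.

(** * Advice and certificates for the complement of [L] *)

Section Collapse.

Variables (cls : cnf -> bool) (g : seq bool -> seq bool) (kc kd : nat).
Hypothesis cls_light : forall F, all light F -> cls F.
Hypothesis g_kernel : forall x k, exists x' k',
  g (enc_pk x k) = enc_pk x' k' /\
  (SAT3_backdoor cls x k <-> SAT3_backdoor cls x' k') /\ size x' + k' <= kc * k.+1 ^ kd.

Variables (L : seq bool -> Prop) (M : tm) (f : seq bool -> seq bool) (c d qc qd : nat).
Hypothesis M_computes : forall x,
  exists cfg, run (c * (size x).+1 ^ d) (init M x) = Some cfg /\ output cfg = f x.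
Hypothesis L_witness : forall x,
  L x <-> exists y, size y <= qc * (size x).+1 ^ qd /\ f (pair_enc x y) = [:: true].

Variable esel : nat -> nat.
Hypothesis eselP : forall v, 2 * (kc * (v + (esel v).+1).+1 ^ kd) + 3 <= 2 ^ esel v.
Hypothesis esel_poly : poly_bounded (fun v => 2 ^ esel v).

Definition wlen (n : nat) := qc * n.+1 ^ qd.
Definition horizon (n : nat) := (2 * n + 2 + wlen n) + c * (2 * n + 2 + wlen n).+1 ^ d.
Definition tableau_size (n : nat) := (horizon n).+1 * (horizon n).*2.+2 * ((tm_n M).+1 + 3).
Definition nbits (n : nat) := esel (tableau_size n).
Definition nvars (n : nat) :=
  tableau_size n + (nbits n).+1 + (nbits n).+1 * 2 ^ nbits n.
(** The kernel is compared as a text [enc_pk x' k'], where pairing doubles x' and adds a separator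
    of two bits. *)
Definition kernel_size (n : nat) := 2 * (kc * (tableau_size n + (nbits n).+1).+1 ^ kd) + 2.

Lemma card_bvarE n : #|{: bvar M (horizon n) (nbits n)}| = tableau_size n + (nbits n).+1.
Proof. by rewrite card_sum !card_prod !card_ord card_sum card_ord card_option card_bool. Qed.

Lemma card_ivarE n : #|{: ivar M (horizon n) (nbits n)}| = nvars n.
Proof. by rewrite card_sum card_bvarE card_prod !card_ord prednK ?expn_gt0. Qed.

Lemma L_accepting n x : size x = n ->
  L x <-> exists y, accepting f n (wlen n) x y.
Proof.
move=> szx; rewrite L_witness szx; split=> [[y [szy fy]]|[y [_ szy fy]]]; first by exists y; split.
by exists y.
Qed.

Definition verifiable (w : seq bool) : Prop :=
  exists y, size y <= 1 * (size w).+1 ^ 2 /\ verify g (pair_enc w y).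

Definition advice_bound (n : nat) : nat :=
  template_bound (2 ^ nbits n) n (nvars n) + n.+1 * (2 * kernel_size n + 1).

(** The cover of the nonmembers yields completeness. For soundness, a tuple with a listed kernel is
    equivalent to a tuple of nonmembers with that kernel, so none of its words is in [L]. *)
Lemma advice_exists n : exists adv : seq bool, size adv <= advice_bound n /\
  forall x, size x = n -> (~ L x <-> verifiable (pair_enc x adv)).
Proof.
set q := wlen n; set T := horizon n; set e := nbits n; set t := 2 ^ e.
have T_input : 2 * n + 2 + q <= T by rewrite leq_addr.
have T_time : c * (2 * n + 2 + q).+1 ^ d <= T by rewrite leq_addl.
have t_gt0 : 0 < t by rewrite expn_gt0.
set B := backdoor M T e; pose F us := formula M f n q T e us.
pose text us := enc_pk (enc_inst (F us) B) (size B).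
have szB : size B = tableau_size n + (nbits n).+1 by rewrite size_backdoor card_bvarE.
have size_gtext us : size (g (text us)) <= kernel_size n.
  have [x' [k' [-> [_ le]]]] := g_kernel (enc_inst (F us) B) (size B).
  by rewrite szB in le; rewrite size_pair_enc size_nseq /kernel_size; lia.
have instance us : (forall i, size (us i) = n) ->
    SAT3_backdoor cls (enc_inst (F us) B) (size B) <-> exists i, i < t /\ L (rev (us i)).
  move=> szus; split=> [[F' [B' [eqx [_ [_ [_ [_ sat]]]]]]]|[i [lti Li]]].
    (* Only the formula has to be recovered; satisfiability does not refer to the backdoor. *)
    have [eqF _] := enc_cnf_inj eqx; rewrite -eqF in sat.
    have [i [y [lti acc]]] := satisfiable_elim M_computes T_input T_time szus sat.
    exists i; split=> //; apply/(@L_accepting n); first by rewrite size_rev.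
    by exists y.
  have szi : size (rev (us i)) = n by rewrite size_rev.
  have [y acc] := (L_accepting szi).1 Li.
  exists (F us), B; split=> //; split; first exact: formula_3CNF.
  split; first exact: uniq_backdoor.
  split=> //; split; last exact: (satisfiable_intro M T_input T_time lti szus acc).
  by move=> tau; apply: cls_light; exact: reduce_light.
pose S := [set u : n.-tuple bool | asbool (~ L (rev u))].
pose us_of (h : {ffun 'I_t -> n.-tuple bool}) (i : nat) : seq bool :=
  if insub i is Some r then val (h r) else nseq n false.
have size_us_of h i : size (us_of h i) = n.
  by rewrite /us_of; case: insubP => [r _ _|_]; rewrite ?size_tuple ?size_nseq.
pose m := kernel_size n.
(* Outputs become elements of a finite type; by [size_gtext] the default value never occurs. *)
pose code h : m.-bseq bool := insubd [bseq] (g (text (us_of h))).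
have codeE h : bseqval (code h) = g (text (us_of h)).
  by rewrite -[bseqval _]/(val _) val_insubd size_gtext.
(* There are fewer than 2 ^ (m + 1) texts of at most m bits; with the 2 in [kernel_size] this
   explains the 3 in [eselP]. *)
have cardO : #|{: m.-bseq bool}| <= 2 ^ t.
  apply: (@leq_trans (2 ^ m.+1)).
    have := predn_exp 2 m.+1; rewrite mul1n card_bseq card_bool => <-; exact: leq_pred.
  by rewrite leq_exp2l // /t /e /nbits; have := eselP (tableau_size n); rewrite /m /kernel_size /nbits; lia.
(* The covering lemma wants a strict bound and all 2 ^ n words may be nonmembers, whence n + 1
   kernels. *)
have cardS : #|S| < 2 ^ n.+1.
  apply: (@leq_ltn_trans #|{: n.-tuple bool}|); first exact: max_card.
  by rewrite card_tuple card_bool ltn_exp2l.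
have [A [szA Acov Aim]] := few_outputs_cover code cardO t_gt0 cardS.
pose A' := [seq bseqval o | o : m.-bseq bool <- A].
pose adv := advice t n (word_prefix M T e) (word_suffix M n T e) (fixed_tail M f n q T e) A'.
exists adv; split.
  rewrite /adv /advice size_cat /advice_bound leq_add //.
    by have := size_template M f n q T e; rewrite card_ivarE.
  apply: leq_trans (size_list_code (m := m) _) _.
    by move=> a /mapP[b _ ->]; exact: size_bseq.
  by rewrite size_map leq_mul2r szA orbT.
move=> x szx; split=> [nLx|[y [_ ver]] Lx].
  have szrx : size (rev x) == n by rewrite size_rev szx.
  have [|h [hS hA [i hi]]] := Acov (Tuple szrx).
    by rewrite inE; apply/asboolP; rewrite /= revK.
  have us_i : us_of h i = rev x by rewrite /us_of valK hi.
  have gA : g (output_text t n (word_prefix M T e) (word_suffix M n T e)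
      (fixed_tail M f n q T e) (us_of h)) \in A'.
    by rewrite output_text_inst // -/(F _) -/B -/(text _) -codeE; exact: map_f.
  have [y szy ver] := verify_complete (size_us_of h) (ltn_ord i) us_i gA.
  exists y; split=> //; apply: (leq_trans szy).
  rewrite size_pair_enc szx /adv /advice size_cat size_map.
  have := size_template_geq M f n q T e; have := size_list_code_geq A'; rewrite size_map.
  rewrite -/t mul1n; move: (size A) (size (template _ _ _ _ _)) (size (list_code A')) => a b l.
  by rewrite expnS expn1; nia.
have [us [szus [i [lti usi]] /mapP[o oA gE]]] := verify_sound szx t_gt0 ver.
rewrite output_text_inst // -/(F _) -/B -/(text _) in gE.
have [h [hS hE]] := Aim o oA; rewrite -hE codeE in gE.
have [x1 [k1 [g1 [P1 _]]]] := g_kernel (enc_inst (F us) B) (size B).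
have [x2 [k2 [g2 [P2 _]]]] := g_kernel (enc_inst (F (us_of h)) B) (size B).
have [ex ek] : x1 = x2 /\ k1 = k2 by apply: enc_pk_inj; rewrite -g1 -g2.
have : SAT3_backdoor cls (enc_inst (F us) B) (size B).
  by apply/(instance us szus); exists i; rewrite usi revK.
move/P1; rewrite ex ek => /P2 /(instance _ (size_us_of h))[i' [lti' Li']].
have := hS (Ordinal lti'); rewrite inE => /asboolP[]; move: Li'.
by rewrite /us_of insubT.
Qed.

Lemma advice_bound_poly : poly_bounded advice_bound.
Proof.
have wlen_poly : poly_bounded wlen by rewrite /wlen; poly_bound.
have horizon_poly : poly_bounded horizon by rewrite /horizon; poly_bound.
have tableau_poly : poly_bounded tableau_size.
  apply: (poly_bounded_leq (h := fun n => (horizon n).+1 * (2 * horizon n).+2 * ((tm_n M).+1 + 3))).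
    by move=> n; rewrite /tableau_size -mul2n.
  by poly_bound.
have t_poly : poly_bounded (fun n => 2 ^ nbits n).
  exact: (poly_bounded_comp esel_poly tableau_poly).
have nbits_poly : poly_bounded nbits.
  by apply: poly_bounded_leq t_poly => n; rewrite ltnW // ltn_expl.
have nvars_poly : poly_bounded nvars by rewrite /nvars; poly_bound.
have kernel_poly : poly_bounded kernel_size by rewrite /kernel_size; poly_bound.
by rewrite /advice_bound /template_bound /fixed_bound; poly_bound.
Qed.

Hypothesis g_poly : poly_time_computable g.

Lemma collapse : coNP_poly L.
Proof.
exists verifiable; split.
  exists (fun z => verify g z); split; last by exists 1, 2.
  by have [Mg [cg [dg Mg_computes]]] := g_poly; exact: verify_poly_time Mg_computes.
have [a aP] := fun_choice advice_exists.
have [ac [ad boundP]] := advice_bound_poly.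
exists a, ac, ad; split=> [n|x].
  by have [sza _] := aP n; exact: leq_trans (boundP n).
by have [_ H] := aP (size x); exact: H.
Qed.

End Collapse.

Lemma kernel_collapse (cls : cnf -> bool) : (forall F, all light F -> cls F) ->
  has_poly_kernel (SAT3_backdoor cls) -> NP_subset_coNP_poly.
Proof.
move=> cls_light [g [g_poly [kc [kd g_kernel]]]] L [V [[f [[M [c [d M_computes]]] fV]] [qc [qd LV]]]].
have [esel [eselP esel_poly]] := selector_length kc kd.
apply: (collapse cls_light g_kernel M_computes (qc := qc) (qd := qd) _ eselP esel_poly g_poly) => x.
by rewrite LV; split=> -[y [szy Vy]]; exists y; split=> //; apply/fV.
Qed.

Theorem theorem5 :
  (has_poly_kernel SAT3_Horn_backdoor -> NP_subset_coNP_poly) /\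
  (has_poly_kernel SAT3_2CNF_backdoor -> NP_subset_coNP_poly).
Proof.
split; apply: kernel_collapse; [exact: light_Horn | exact: light_2CNF].
Qed.
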